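(* Let $\pi: P\to H$ be a surjection of Hopf algebras over a field $k$ and let $B:=P^H=\{p\in P : p_{(1)}\otimes \pi(p_{(2)})=p\otimes 1\}$. Then the category $\dot{\mathcal{M}}^H_B$ (crossed right $B$-module right $H$-comodules) and the category ${}^P_P\mathcal{M}^H_B$ (compatible left $P$-module, left $P$-comodule, right $B$-module, right $H$-comodules) are equivalent.
   Context: All Hopf algebras, (co)modules and tensor products are over a field $k$. Coproduct, counit and antipode are $\Delta,\epsilon,\mathrm{S}$, with Sweedler notation $\Delta h=h_{(1)}\otimes h_{(2)}$. Left coactions are written $v\mapsto v_{(1)}\otimes v_{(\underline{2})}$ and right coactions $v\mapsto v_{(\underline{1})}\otimes v_{(2)}$; the underlined leg lies in the comodule. A surjection of Hopf algebras is a surjective Hopf algebra homomorphism. $B=P^H$ is a subalgebra of $P$ with $\Delta(B)\subseteq P\otimes B$, so it is a left $P$-comodule algebra via $\Delta$. The category $\dot{\mathcal{M}}^H_B$: objects are vector spaces $X$ with a right $B$-module structure $\triangleleft$ and a right $H$-comodule structure satisfying the crossed condition $$x_{(\underline{1})}\triangleleft b\otimes x_{(2)}=(x\triangleleft b_{(2)})_{(\underline{1})}\otimes \pi(b_{(1)})\,(x\triangleleft b_{(2)})_{(2)}\qquad \text{for all } x\in X,\ b\in B.$$ Morphisms are linear maps that are $B$-linear and $H$-colinear. The category ${}^P_P\mathcal{M}^H_B$: objects are vector spaces $Y$ with a left $P$-module structure $\triangleright$, a left $P$-comodule structure, a right $B$-module structure $\triangleleft$ and a right $H$-comodule structure that are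 mutually compatible (Hopf module type compatibility). That is, the two actions commute, the two coactions commute, and for all $p\in P$, $b\in B$, $y\in Y$: - $(p\triangleright y)_{(1)}\otimes (p\triangleright y)_{(\underline{2})}=p_{(1)}y_{(1)}\otimes p_{(2)}\triangleright y_{(\underline{2})}$ in $P\otimes Y$; - $(y\triangleleft b)_{(1)}\otimes (y\triangleleft b)_{(\underline{2})}=y_{(1)}b_{(1)}\otimes y_{(\underline{2})}\triangleleft b_{(2)}$ in $P\otimes Y$; - $(p\triangleright y)_{(\underline{1})}\otimes (p\triangleright y)_{(2)}=p_{(1)}\triangleright y_{(\underline{1})}\otimes \pi(p_{(2)})y_{(2)}$ in $Y\otimes H$; - $(y\triangleleft b)_{(\underline{1})}\otimes (y\triangleleft b)_{(2)}=y_{(\underline{1})}\triangleleft b\otimes y_{(2)}$ in $Y\otimes H$. Morphisms are linear maps respecting all four structures. *)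

(* Defs.v *)
From HB Require Import structures.
From mathcomp Require Import all_boot all_order all_algebra.
From mathcomp Require Import boolp classical_sets.

Set Implicit Arguments.
Unset Strict Implicit.
Unset Printing Implicit Defensive.

Import GRing.Theory.
Local Open Scope ring_scope.
Local Open Scope quotient_scope.

Reserved Notation "v ⊗ w" (at level 40, left associativity).
Reserved Notation "'\sw_' ( a ⊗ b <- t ) F"
  (at level 41, a name, b name, t at level 100, F at level 41,
   format "'[' '\sw_' ( a  ⊗  b  <-  t ) '/  '  F ']'").

Section Tensor.
Variables (k : fieldType) (V W : lmodType k).

(* The formal sum v1 (x) w1 + ... + vn (x) wn is the sequence of the pairs    *)
(* (vi, wi); tensor_eq is the congruence generated by bilinearity.            *)
Inductive tensor_eq : seq (V * W) -> seq (V * W) -> Prop :=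
| tensor_eq_refl s : tensor_eq s s
| tensor_eq_sym s t : tensor_eq s t -> tensor_eq t s
| tensor_eq_trans s t u : tensor_eq s t -> tensor_eq t u -> tensor_eq s u
| tensor_eq_cat s s' t t' :
    tensor_eq s s' -> tensor_eq t t' -> tensor_eq (s ++ t) (s' ++ t')
| tensor_eq_catC s t : tensor_eq (s ++ t) (t ++ s)
| tensor_eq_0l w : tensor_eq [:: (0, w)] [::]
| tensor_eq_addl v v' w :
    tensor_eq [:: (v + v', w)] [:: (v, w); (v', w)]
| tensor_eq_addr v w w' :
    tensor_eq [:: (v, w + w')] [:: (v, w); (v, w')]
| tensor_eq_scale a v w :
    tensor_eq [:: (a *: v, w)] [:: (v, a *: w)].

Definition tensor_eqb : rel (seq (V * W)) := fun s t => `[< tensor_eq s t >].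

Lemma tensor_eqb_refl : reflexive tensor_eqb.
Proof. by move=> s; apply/asboolP; exact: tensor_eq_refl. Qed.

Lemma tensor_eqb_sym : symmetric tensor_eqb.
Proof.
by move=> s t; apply/idP/idP => /asboolP st; apply/asboolP;
  exact: tensor_eq_sym.
Qed.

Lemma tensor_eqb_trans : transitive tensor_eqb.
Proof.
move=> t s u /asboolP st /asboolP tu.
by apply/asboolP; exact: tensor_eq_trans tu.
Qed.

Canonical tensor_eqb_equiv :=
  EquivRel tensor_eqb tensor_eqb_refl tensor_eqb_sym tensor_eqb_trans.

Definition tensor := {eq_quot tensor_eqb}.

HB.instance Definition _ := Choice.on tensor.
HB.instance Definition _ := EqQuotient.on tensor.

Lemma tensor_piP s t : reflect (tensor_eq s t) (\pi_tensor s == \pi_tensor t).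
Proof. by rewrite eqmodE; exact: asboolP. Qed.

Lemma tensor_repr s : tensor_eq (repr (\pi_tensor s)) s.
Proof. by apply/tensor_piP; rewrite reprK. Qed.

Definition pure (v : V) (w : W) : tensor := \pi_tensor [:: (v, w)].

Definition tensor_add := lift_op2 tensor cat.
Definition tensor_scale (a : k) :=
  lift_op1 tensor (map (fun vw : V * W => (a *: vw.1, vw.2))).

Lemma tensor_addE s t :
  tensor_add (\pi_tensor s) (\pi_tensor t) = \pi_tensor (s ++ t).
Proof.
rewrite /tensor_add -lock; apply/eqP/tensor_piP/tensor_eq_cat;
  exact: tensor_repr.
Qed.

Lemma tensor_eq_map a s t : tensor_eq s t ->
  tensor_eq [seq (a *: vw.1, vw.2) | vw <- s]
            [seq (a *: vw.1, vw.2) | vw <- t].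
Proof.
elim => {s t}.
- by move=> s; exact: tensor_eq_refl.
- by move=> s t _; exact: tensor_eq_sym.
- by move=> s t u _ st _; exact: tensor_eq_trans.
- by move=> s s' t t' _ ss' _ tt'; rewrite !map_cat; exact: tensor_eq_cat.
- by move=> s t; rewrite !map_cat; exact: tensor_eq_catC.
- by move=> w /=; rewrite scaler0; exact: tensor_eq_0l.
- by move=> v v' w /=; rewrite scalerDr; exact: tensor_eq_addl.
- by move=> v w w' /=; exact: tensor_eq_addr.
- move=> b v w /=; rewrite scalerA mulrC -scalerA; exact: tensor_eq_scale.
Qed.

Lemma tensor_scaleE a s :
  tensor_scale a (\pi_tensor s) = \pi_tensor [seq (a *: vw.1, vw.2) | vw <- s].
Proof.
rewrite /tensor_scale -lock; apply/eqP/tensor_piP/tensor_eq_map.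
exact: tensor_repr.
Qed.

Lemma tensor_addA : associative tensor_add.
Proof.
move=> x y z; rewrite -[x]reprK -[y]reprK -[z]reprK.
by rewrite !tensor_addE catA.
Qed.

Lemma tensor_addC : commutative tensor_add.
Proof.
by move=> x y; rewrite /tensor_add -lock; apply/eqP/tensor_piP;
  exact: tensor_eq_catC.
Qed.

Lemma tensor_add0 : left_id (\pi_tensor [::]) tensor_add.
Proof. by move=> x; rewrite -[x]reprK tensor_addE. Qed.

Lemma tensor_eq_scaleD a b s :
  tensor_eq [seq ((a + b) *: vw.1, vw.2) | vw <- s]
    ([seq (a *: vw.1, vw.2) | vw <- s] ++ [seq (b *: vw.1, vw.2) | vw <- s]).
Proof.
elim: s => [|[v w] s IH] /=; first exact: tensor_eq_refl.
set AB := map _ s in IH *; set B := map _ s in IH *.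
set B' := map _ s in IH *.
apply: (@tensor_eq_trans _ ([:: (a *: v, w); (b *: v, w)] ++ (B ++ B'))).
  by rewrite -cat1s scalerDl; apply: tensor_eq_cat IH; exact: tensor_eq_addl.
apply: (@tensor_eq_cat [:: (a *: v, w)] [:: (a *: v, w)]
  ([:: (b *: v, w)] ++ (B ++ B')) (B ++ [:: (b *: v, w)] ++ B')).
  exact: tensor_eq_refl.
rewrite !catA; apply: tensor_eq_cat; last exact: tensor_eq_refl.
exact: tensor_eq_catC.
Qed.

Lemma tensor_addN : left_inverse (\pi_tensor [::]) (tensor_scale (-1)) tensor_add.
Proof.
move=> x; rewrite -[x]reprK tensor_scaleE tensor_addE; apply/eqP/tensor_piP.
set s := repr x.
have -> : s = [seq (1 *: vw.1, vw.2) | vw <- s].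
  by rewrite -[LHS]map_id; apply: eq_map => -[v w]; rewrite scale1r.
rewrite -map_comp (_ : [seq _ | _ <- s] = [seq ((-1) *: vw.1, vw.2) | vw <- s]);
  last by apply: eq_map => -[v w] /=; rewrite scale1r.
apply: tensor_eq_trans (tensor_eq_sym (tensor_eq_scaleD _ _ _)) _.
rewrite addNr; elim: s => [|[v w] s IH] /=; first exact: tensor_eq_refl.
rewrite scale0r -cat1s -[[::]]cat0s; apply: tensor_eq_cat IH.
exact: tensor_eq_0l.
Qed.

HB.instance Definition _ := GRing.isZmodule.Build tensor
  tensor_addA tensor_addC tensor_add0 tensor_addN.

Lemma pi_tensorD s t : \pi_tensor s + \pi_tensor t = \pi_tensor (s ++ t).
Proof. exact: tensor_addE. Qed.

Lemma tensor_scaleA a b x :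
  tensor_scale a (tensor_scale b x) = tensor_scale (a * b) x.
Proof.
rewrite -[x]reprK !tensor_scaleE -map_comp; congr (\pi_tensor _).
by apply: eq_map => -[v w] /=; rewrite scalerA.
Qed.

Lemma tensor_scale1 : left_id 1 tensor_scale.
Proof.
move=> x; rewrite -[x]reprK tensor_scaleE; congr (\pi_tensor _).
by rewrite -[RHS]map_id; apply: eq_map => -[v w]; rewrite scale1r.
Qed.

Lemma tensor_scaleDr : right_distributive tensor_scale +%R.
Proof.
move=> a x y; rewrite -[x]reprK -[y]reprK pi_tensorD !tensor_scaleE.
by rewrite pi_tensorD map_cat.
Qed.

Lemma tensor_scaleDl x : {morph tensor_scale^~ x : a b / a + b}.
Proof.
move=> a b; rewrite -[x]reprK !tensor_scaleE pi_tensorD.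
exact/eqP/tensor_piP/tensor_eq_scaleD.
Qed.

HB.instance Definition _ := GRing.Zmodule_isLmodule.Build k tensor
  tensor_scaleA tensor_scale1 tensor_scaleDr tensor_scaleDl.

End Tensor.

Notation "V ⊗ W" := (tensor V W) : type_scope.
Notation "v ⊗ w" := (pure v w) : ring_scope.

Section Linear.
Variables (k : fieldType) (V U : lmodType k).

Lemma linear_sum (f : V -> U) : linear f -> forall I (s : seq I) (G : I -> V),
  f (\sum_(i <- s) G i) = \sum_(i <- s) f (G i).
Proof.
move=> fL I s G; pose g : {linear V -> U} :=
  HB.pack f (GRing.isLinear.Build k V U *:%R f fL).
exact: (raddf_sum g).
Qed.

Lemma linear_0 (f : V -> U) : linear f -> f 0 = 0.
Proof.
by move=> fL; have := fL (-1) 0 0; rewrite scaler0 addr0 scaleN1r addNr.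
Qed.

End Linear.

Section Sweedler.
Variables (k : fieldType) (V W U : lmodType k).

Definition bilinear_map (F : V -> W -> U) :=
  (forall w, linear (F^~ w)) /\ (forall v, linear (F v)).

(* Sweedler sum of F over a chosen expression of t as a sum of pure tensors;  *)
(* by sweedlerP and sweedler_pure below, when F is bilinear this is the value *)
(* at t of the linear map induced by F.                                       *)
Definition sweedler (t : V ⊗ W) (F : V -> W -> U) : U :=
  \sum_(vw <- repr t) F vw.1 vw.2.

End Sweedler.

Notation "'\sw_' ( a ⊗ b <- t ) F" :=
  (sweedler t (fun a b => F)) : ring_scope.

Section TensorTheory.
Variables (k : fieldType) (V W : lmodType k).
Implicit Types (v : V) (w : W).

Lemma pure_linearl w : linear (fun v => v ⊗ w).
Proof.
move=> a v v'; transitivity ((a *: v) ⊗ w + v' ⊗ w).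
  rewrite pi_tensorD; apply/eqP/tensor_piP; exact: tensor_eq_addl.
congr (_ + _); rewrite /pure [RHS]tensor_scaleE //.
Qed.

Lemma pure_scale a v w : (a *: v) ⊗ w = v ⊗ (a *: w).
Proof. apply/eqP/tensor_piP; exact: tensor_eq_scale. Qed.

Lemma pure_linearr v : linear (fun w => v ⊗ w).
Proof.
move=> a w w'; transitivity (v ⊗ (a *: w) + v ⊗ w').
  rewrite pi_tensorD; apply/eqP/tensor_piP; exact: tensor_eq_addr.
by rewrite -pure_scale; congr (_ + _); rewrite /pure [RHS]tensor_scaleE.
Qed.

Lemma pure_bilinear : bilinear_map (@pure k V W).
Proof. by split; [exact: pure_linearl|exact: pure_linearr]. Qed.

Lemma pi_tensor_sum s :
  \pi_(V ⊗ W)%type s = \sum_(vw <- s) vw.1 ⊗ vw.2.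
Proof.
elim: s => [|[v w] s IH]; first by rewrite big_nil.
by rewrite big_cons -IH pi_tensorD.
Qed.

Lemma tensorE (t : V ⊗ W) : t = \sw_(v ⊗ w <- t) v ⊗ w.
Proof. by rewrite /sweedler -pi_tensor_sum reprK. Qed.

Variable U : lmodType k.

Lemma tensor_eq_bilinear (F : V -> W -> U) s t : bilinear_map F ->
  tensor_eq s t ->
  \sum_(vw <- s) F vw.1 vw.2 = \sum_(vw <- t) F vw.1 vw.2.
Proof.
move=> [Fl Fr]; elim => {s t} //=.
- by move=> s t u _ -> _ ->.
- by move=> s s' t t' _ ss' _ tt'; rewrite !big_cat /= ss' tt'.
- by move=> s t; rewrite !big_cat /= addrC.
- by move=> w; rewrite big_seq1 big_nil (linear_0 (Fl w)).
- by move=> v v' w; rewrite !big_cons !big_nil !addr0 /= -[v]scale1r Fl !scale1r.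
- by move=> v w w'; rewrite !big_cons !big_nil !addr0 /= -[w]scale1r Fr !scale1r.
- move=> a v w; rewrite !big_seq1 /= -[a *: v]addr0 -[a *: w]addr0 Fl Fr.
  by rewrite (linear_0 (Fl w)) (linear_0 (Fr v)).
Qed.

Lemma sweedler_pi (F : V -> W -> U) s : bilinear_map F ->
  sweedler (\pi_(V ⊗ W)%type s) F = \sum_(vw <- s) F vw.1 vw.2.
Proof.
by move=> FL; apply: tensor_eq_bilinear => //; exact: tensor_repr.
Qed.

Lemma sweedler_pure (F : V -> W -> U) v w : bilinear_map F ->
  sweedler (v ⊗ w) F = F v w.
Proof. by move=> FL; rewrite sweedler_pi // big_seq1. Qed.

Lemma sweedlerP (F : V -> W -> U) : bilinear_map F ->
  linear (fun t => sweedler t F).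
Proof.
move=> FL a x y; rewrite -[x]reprK -[y]reprK.
rewrite [a *: _]tensor_scaleE pi_tensorD !sweedler_pi // big_cat /=.
congr (_ + _); rewrite big_map /= scaler_sumr; apply: eq_bigr => -[v w] _ /=.
by rewrite -[a *: v]addr0 FL.1 (linear_0 (FL.1 w)) addr0.
Qed.

Lemma tensor_ext (f g : V ⊗ W -> U) : linear f -> linear g ->
  (forall v w, f (v ⊗ w) = g (v ⊗ w)) -> f =1 g.
Proof.
move=> fL gL fg t; rewrite [t]tensorE /sweedler !linear_sum //.
by apply: eq_bigr => -[v w] _; exact: fg.
Qed.

End TensorTheory.

Section Splitting.
Variables (k : fieldType).

Definition subspace (V : lmodType k) (K : set V) :=
  K 0 /\ forall a u v, K u -> K v -> K (a *: u + v).

Lemma subspaceZ (V : lmodType k) (K : set V) a u :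
  subspace K -> K u -> K (a *: u).
Proof. by move=> [K0 KL] Ku; rewrite -[_ *: _]addr0; exact: KL. Qed.

Lemma subspace_complement (V : lmodType k) (K : set V) : subspace K ->
  exists C, [/\ subspace C, (forall v, K v -> C v -> v = 0) &
    forall v, exists u w, [/\ K u, C w & v = u + w]].
Proof.
move=> Ksub; pose P (C : set V) :=
  (forall a u v, C u -> C v -> C (a *: u + v)) /\
  (forall v, K v -> C v -> v = 0).
have [F FP Ftot|C [[CL CK] Cmax]] := @Zorn_bigcup V P.
  split=> [a u v [X FX Xu] [Y FY Yv]|v Kv [X FX Xv]]; last first.
    by have [_] := FP _ FX; apply.
  have [XY|YX] := Ftot _ _ FX FY.
    by exists Y => //; have [YL _] := FP _ FY; apply: YL => //; exact: XY.
  by exists X => //; have [XL _] := FP _ FX; apply: XL => //; exact: YX.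
have C0 : C 0.
  apply: contrapT => nC0; apply: (Cmax (C `|` [set 0])%classic).
    by split=> [|sub]; [exact: subsetUl|apply: nC0; apply: sub; right].
  split=> [a u v|v Kv [|//]]; last exact: CK.
  move=> [Cu|->] [Cv|->]; rewrite ?scaler0 ?add0r ?addr0.
  - by left; exact: CL.
  - have [u0|/eqP u0] := eqVneq u 0; first by rewrite u0 scaler0; right.
    left; rewrite (_ : a *: u = (a - 1) *: u + u); first exact: CL.
    by rewrite scalerBl scale1r subrK.
  - by left.
  - by right.
exists C; split=> // v; apply: contrapT => nv.
pose D : set V := fun x => exists a w, C w /\ x = a *: v + w.
apply: (Cmax D).
  split=> [w Cw|sub]; first by exists 0, w; rewrite scale0r add0r.
  apply: nv; exists 0, v; rewrite add0r; split=> //; first exact: Ksub.1.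
  by apply: sub; exists 1, 0; rewrite scale1r addr0.
split=> [a _ _ [b [w [Cw ->]]] [c [w' [Cw' ->]]]|x Kx [a [w [Cw xE]]]].
  exists (a * b + c), (a *: w + w'); split; first exact: CL.
  by rewrite scalerDl scalerDr scalerA addrACA.
have [a0|a0] := eqVneq a 0.
  by apply: CK => //; rewrite xE a0 scale0r add0r.
case: nv; exists (a^-1 *: x), ((- a^-1) *: w); split.
- exact: subspaceZ.
- exact: subspaceZ.
- by rewrite xE scalerDr scalerA mulVf // scale1r scaleNr addrK.
Qed.

Lemma generalized_inverse (V W : lmodType k) (phi : V -> W) : linear phi ->
  exists psi : W -> V, linear psi /\ forall v, phi (psi (phi v)) = phi v.
Proof.
move=> phiL.
have phi0 := linear_0 phiL.
have phiD u v : phi (u + v) = phi u + phi v.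
  by rewrite -[u]scale1r phiL !scale1r.
have phiB u v : phi (u - v) = phi u - phi v.
  by rewrite addrC -scaleN1r phiL scaleN1r addrC.
pose K : set V := fun v => phi v = 0.
have Ksub : subspace K.
  by split=> // a u v; rewrite /K phiL => -> ->; rewrite scaler0 addr0.
have [C [[C0 CL] CK CV]] := subspace_complement Ksub.
pose R : set W := fun w => exists v, w = phi v.
have Rsub : subspace R.
  split; first by exists 0.
  by move=> a _ _ [u ->] [v ->]; exists (a *: u + v); rewrite phiL.
have [D [[D0 DL] DR DW]] := subspace_complement Rsub.
have ex w : exists c, C c /\ D (w - phi c).
  have [_ [d [[v ->] Dd ->]]] := DW w.
  have [u [c [Ku Cc vE]]] := CV v.
  by exists c; split=> //; rewrite vE phiD Ku add0r addrAC subrr add0r.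
have [psi psiP] := choice ex.
have CB u v : C u -> C v -> C (u - v).
  by move=> Cu Cv; rewrite addrC -scaleN1r; exact: CL.
have DB u v : D u -> D v -> D (u - v).
  by move=> Cu Cv; rewrite addrC -scaleN1r; exact: DL.
have uniq w c : C c -> D (w - phi c) -> psi w = c.
  move=> Cc Dc; have [Cw Dw] := psiP w.
  apply/eqP; rewrite -subr_eq0; apply/eqP; apply: CK; last exact: CB.
  rewrite /K; apply: DR; first by exists (psi w - c).
  have := DB _ _ Dc Dw; rewrite opprB addrC addrA subrK phiB.
  by rewrite addrC.
exists psi; split=> [a w w'|v].
  have [[Cw Dw] [Cw' Dw']] := (psiP w, psiP w').
  apply: uniq; first exact: CL.
  rewrite phiL opprD addrACA -scalerBr; exact: DL.
have [u [c [Ku Cc ->]]] := CV v.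
by rewrite phiD Ku add0r (uniq _ c) ?subrr.
Qed.

End Splitting.

Section LinearCombinators.
Variables (k : fieldType).
Implicit Types U V W X Y : lmodType k.

Lemma linear_id U : linear (fun u : U => u).
Proof. by []. Qed.

Lemma linear_comp U V W (f : V -> W) (g : U -> V) :
  linear f -> linear g -> linear (fun u => f (g u)).
Proof. by move=> fL gL a u v; rewrite gL fL. Qed.

Lemma linear_sub U V (f g : U -> V) :
  linear f -> linear g -> linear (fun u => f u - g u).
Proof. by move=> fL gL a u v; rewrite fL gL opprD addrACA scalerBr. Qed.

Lemma linear_pure U V W (f : U -> V) (w : W) :
  linear f -> linear (fun u => f u ⊗ w).
Proof. by move=> fL; exact: linear_comp (@pure_linearl k V W w) fL. Qed.

Lemma linear_purer U V W (f : U -> W) (v : V) :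
  linear f -> linear (fun u => v ⊗ f u).
Proof. by move=> fL; exact: linear_comp (@pure_linearr k V W v) fL. Qed.

Lemma bilinear_pure U V W X (f : U -> V) (g : W -> X) :
  linear f -> linear g -> bilinear_map (fun u w => f u ⊗ g w).
Proof. by move=> fL gL; split=> u; [exact: linear_pure|exact: linear_purer]. Qed.

Lemma linear_sweedler U V W X (t : U -> V ⊗ W) (F : V -> W -> X) :
  linear t -> bilinear_map F -> linear (fun u => \sw_(v ⊗ w <- t u) F v w).
Proof. by move=> tL FL; exact: linear_comp (sweedlerP FL) tL. Qed.

Lemma linear_sweedlerF U V W X (t : V ⊗ W) (F : U -> V -> W -> X) :
  (forall v w, linear (fun u => F u v w)) ->
  linear (fun u => \sw_(v ⊗ w <- t) F u v w).
Proof.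
move=> FL a u u'; rewrite /sweedler scaler_sumr -big_split /=.
by apply: eq_bigr => vw _; exact: FL.
Qed.

Lemma linear_sw V W X Y (f : X -> Y) (t : V ⊗ W) (F : V -> W -> X) :
  linear f -> f (\sw_(v ⊗ w <- t) F v w) = \sw_(v ⊗ w <- t) f (F v w).
Proof. by move=> fL; rewrite /sweedler linear_sum. Qed.

Lemma sweedlerA U V W X Y (t : V ⊗ W) (G : V -> W -> X ⊗ Y)
    (F : X -> Y -> U) : bilinear_map F ->
  sweedler (\sw_(v ⊗ w <- t) G v w) F = \sw_(v ⊗ w <- t) sweedler (G v w) F.
Proof.
move=> FL; rewrite (linear_sw (f := fun s => sweedler s F)) //.
exact: sweedlerP.
Qed.

Lemma sweedler_map V W V' W' U (t : V ⊗ W) (f : V -> V') (g : W -> W')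
    (F : V' -> W' -> U) : bilinear_map F ->
  sweedler (\sw_(v ⊗ w <- t) f v ⊗ g w) F = \sw_(v ⊗ w <- t) F (f v) (g w).
Proof.
move=> FL; rewrite sweedlerA //.
by apply: eq_bigr => vw _; rewrite sweedler_pure.
Qed.

Lemma eq_sweedler V W U (t : V ⊗ W) (F G : V -> W -> U) :
  (forall v w, F v w = G v w) -> sweedler t F = sweedler t G.
Proof. by move=> FG; apply: eq_bigr => vw _; exact: FG. Qed.

Lemma sweedlerB V W U (t : V ⊗ W) (F G : V -> W -> U) :
  \sw_(v ⊗ w <- t) (F v w - G v w) =
  \sw_(v ⊗ w <- t) F v w - \sw_(v ⊗ w <- t) G v w.
Proof. by rewrite /sweedler sumrB. Qed.

End LinearCombinators.

HB.mixin Record Algebra_isHopf (k : fieldType) A of GRing.Algebra k A := {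
  comul : {linear A -> (A ⊗ A)%type};
  counit : {scalar A};
  antipode : {linear A -> A};
  comulA : forall h : A,
    \sw_(a ⊗ b <- comul h) a ⊗ comul b =
    \sw_(a ⊗ b <- comul h) \sw_(c ⊗ d <- comul a) c ⊗ (d ⊗ b);
  counitl : forall h : A, \sw_(a ⊗ b <- comul h) counit a *: b = h;
  counitr : forall h : A, \sw_(a ⊗ b <- comul h) counit b *: a = h;
  comul1 : comul 1 = 1 ⊗ 1;
  comulM : forall g h : A, comul (g * h) =
    \sw_(a ⊗ b <- comul g) \sw_(c ⊗ d <- comul h) (a * c) ⊗ (b * d);
  counit1 : counit 1 = 1;
  counitM : forall g h : A, counit (g * h) = counit g * counit h;
  antipodel : forall h : A,
    \sw_(a ⊗ b <- comul h) antipode a * b = (counit h)%:A;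
  antipoder : forall h : A,
    \sw_(a ⊗ b <- comul h) a * antipode b = (counit h)%:A
}.

#[short(type="hopfAlgType")]
HB.structure Definition HopfAlgebra (k : fieldType) :=
  {A of Algebra_isHopf k A & GRing.Algebra k A}.

(* Multiplicativity and unitality are carried by {lrmorphism P -> H}; the     *)
(* condition on antipodes is implied by the others.                           *)
Definition hopf_morphism (k : fieldType) (P H : hopfAlgType k)
    (f : {lrmorphism P -> H}) :=
  [/\ forall p, comul (f p) = \sw_(a ⊗ b <- comul p) f a ⊗ f b,
      forall p, counit (f p) = counit p &
      forall p, antipode (f p) = f (antipode p)].

Section Modules.
Variables (k : fieldType).

Record left_module (A : algType k) (V : lmodType k) := LeftModule {
  lact :> A -> V -> V;
  lact_bilinear : bilinear_map lact;
  lact1 : forall v, lact 1 v = v;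
  lactM : forall a b v, lact (a * b) v = lact a (lact b v)
}.

Record right_module (A : algType k) (V : lmodType k) := RightModule {
  ract :> V -> A -> V;
  ract_bilinear : bilinear_map ract;
  ract1 : forall v, ract v 1 = v;
  ractM : forall v a b, ract v (a * b) = ract (ract v a) b
}.

Record left_comodule (C : hopfAlgType k) (V : lmodType k) := LeftComodule {
  lcoact :> V -> C ⊗ V;
  lcoact_linear : linear lcoact;
  lcoactA : forall x,
    \sw_(c ⊗ v <- lcoact x) c ⊗ lcoact v =
    \sw_(c ⊗ v <- lcoact x) \sw_(d ⊗ e <- comul c) d ⊗ (e ⊗ v);
  lcoact_counit : forall x, \sw_(c ⊗ v <- lcoact x) counit c *: v = x
}.

Record right_comodule (C : hopfAlgType k) (V : lmodType k) := RightComodule {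
  rcoact :> V -> V ⊗ C;
  rcoact_linear : linear rcoact;
  rcoactA : forall x,
    \sw_(v ⊗ c <- rcoact x) v ⊗ comul c =
    \sw_(v ⊗ c <- rcoact x) \sw_(w ⊗ d <- rcoact v) w ⊗ (d ⊗ c);
  rcoact_counit : forall x, \sw_(v ⊗ c <- rcoact x) counit c *: v = x
}.

End Modules.

Section Coinvariants.
Variables (k : fieldType) (P H : hopfAlgType k) (pi : {lrmorphism P -> H}).

Definition coinvariant : {pred P} :=
  fun p => \sw_(a ⊗ b <- comul p) a ⊗ pi b == p ⊗ 1.

Lemma comul_linear (A : hopfAlgType k) : linear (@comul k A).
Proof. exact: linearP. Qed.

Lemma pi_linear : linear pi.
Proof. exact: linearP. Qed.

Lemma coinvariant_linear :
  linear (fun p : P => \sw_(a ⊗ b <- comul p) a ⊗ pi b).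
Proof.
apply: linear_sweedler; first exact: comul_linear.
by apply: bilinear_pure; [exact: linear_id|exact: pi_linear].
Qed.

Lemma coinvariant_subalg : GRing.subalg_closed coinvariant.
Proof.
split.
- apply/eqP; rewrite comul1 sweedler_pure ?rmorph1 //.
  by apply: bilinear_pure; [exact: linear_id|exact: pi_linear].
- move=> c p q /eqP pP /eqP qP; apply/eqP.
  by rewrite coinvariant_linear pP qP pure_linearl.
- move=> p q /eqP pP /eqP qP; apply/eqP.
  have mulL (A : algType k) : forall a : A, linear (fun x => a * x).
    by move=> A0 b x y; rewrite mulrDr scalerAr.
  have mulR (A : algType k) : forall a : A, linear (fun x => x * a).
    by move=> A0 b x y; rewrite mulrDl scalerAl.
  have tmulL (a : P) (b : H) :
      bilinear_map (fun c d => (a * c) ⊗ (b * d)).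
    by apply: bilinear_pure; exact: mulL.
  have tmulR (a : P) (b : H) :
      bilinear_map (fun c d => (c * a) ⊗ (d * b)).
    by apply: bilinear_pure; exact: mulR.
  have tmul (t : P ⊗ H) : bilinear_map
      (fun a b => \sw_(c ⊗ d <- t) (a * c) ⊗ (b * d)).
    split=> [b|a]; apply: linear_sweedlerF => c d.
      by apply: linear_pure; exact: mulR.
    by apply: linear_purer; exact: mulR.
  have pureP : bilinear_map (fun (a : P) (b : P) => a ⊗ pi b).
    by apply: bilinear_pure; [exact: linear_id|exact: pi_linear].
  transitivity (\sw_(a ⊗ b <- \sw_(a ⊗ b <- comul p) a ⊗ pi b)
      \sw_(c ⊗ d <- \sw_(c ⊗ d <- comul q) c ⊗ pi d) (a * c) ⊗ (b * d)).
    rewrite sweedler_map // comulM sweedlerA //; apply: eq_sweedler => a b.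
    rewrite sweedler_map // sweedlerA //; apply: eq_sweedler => c d.
    by rewrite sweedler_pure // rmorphM.
  by rewrite pP qP !sweedler_pure // mulr1.
Qed.

HB.instance Definition _ :=
  GRing.isSubalgClosed.Build k P coinvariant coinvariant_subalg.

Record coinvariants := Coinvariants {
  coinv_val :> P;
  coinv_valP : coinv_val \in coinvariant
}.

HB.instance Definition _ := [isSub for coinv_val].
HB.instance Definition _ := [Choice of coinvariants by <:].
HB.instance Definition _ := [SubChoice_isSubAlgebra of coinvariants by <:].

Lemma coinv_val_linear : linear coinv_val.
Proof. by []. Qed.

Lemma coinv_coaction_subproof (b : coinvariants) :
  exists s : P ⊗ coinvariants,
    \sw_(p ⊗ c <- s) p ⊗ coinv_val c = comul (b : P).
Proof.
pose rho (p : P) : P ⊗ H := \sw_(c ⊗ d <- comul p) c ⊗ pi d.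
pose phi p := rho p - p ⊗ 1.
have phiL : linear phi.
  apply: linear_sub; first exact: coinvariant_linear.
  exact/linear_pure/linear_id.
have phi_comul : \sw_(p ⊗ q <- comul (b : P)) p ⊗ phi q = 0.
  pose T (t : P ⊗ P) : P ⊗ H := \sw_(c ⊗ d <- t) c ⊗ pi d.
  pose G (p : P) (h : H) := \sw_(c ⊗ d <- comul p) c ⊗ (d ⊗ h).
  have TF : bilinear_map (fun (c d : P) => c ⊗ pi d).
    by apply: bilinear_pure; [exact: linear_id|exact: pi_linear].
  have TL : linear T by exact: sweedlerP.
  have idT : bilinear_map (fun (p : P) (t : P ⊗ P) => p ⊗ T t).
    by apply: bilinear_pure; [exact: linear_id|exact: TL].
  have dh (h : H) : bilinear_map (fun (c d : P) => c ⊗ (d ⊗ h)).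
    apply: bilinear_pure; first exact: linear_id.
    exact/linear_pure/linear_id.
  have GL : bilinear_map G.
    split=> [h|p].
      by apply: linear_sweedler; [exact: comul_linear|exact: dh].
    apply: linear_sweedlerF => c d.
    exact/linear_purer/linear_purer/linear_id.
  rewrite (@eq_sweedler _ _ _ _ _ _
    (fun p q => p ⊗ rho q - p ⊗ (q ⊗ 1))); last first.
    move=> p q; rewrite /phi -[rho q - _]addrC -scaleN1r pure_linearr.
    by rewrite scaleN1r addrC.
  rewrite sweedlerB; apply/eqP; rewrite subr_eq0; apply/eqP.
  transitivity (\sw_(p ⊗ t <- \sw_(p ⊗ q <- comul (b : P)) p ⊗ comul q)
      p ⊗ T t).
    by rewrite sweedlerA //; apply: eq_sweedler => p q; rewrite sweedler_pure.
  rewrite comulA sweedlerA //.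
  transitivity (\sw_(p ⊗ h <- \sw_(p ⊗ q <- comul (b : P)) p ⊗ pi q) G p h).
    rewrite sweedler_map //; apply: eq_sweedler => p q; rewrite sweedlerA //.
    by apply: eq_sweedler => c d; rewrite sweedler_pure // /T sweedler_pure.
  by have /eqP -> := coinv_valP b; rewrite sweedler_pure.
have [psi [psiL psiK]] := generalized_inverse phiL.
pose r q := q - psi (phi q).
have phi0 q : phi q = 0 -> q \in coinvariant.
  by move=> /eqP; rewrite subr_eq0.
have rP q : r q \in coinvariant.
  by apply: phi0; rewrite /r -[q - _]addrC -scaleN1r phiL scaleN1r psiK addNr.
exists (\sw_(p ⊗ q <- comul (b : P)) p ⊗ Coinvariants (rP q)).
have pF : bilinear_map (fun (p : P) (c : coinvariants) => p ⊗ coinv_val c).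
  by apply: bilinear_pure; [exact: linear_id|exact: coinv_val_linear].
have psiF : bilinear_map (fun (p : P) (t : P ⊗ H) => p ⊗ psi t).
  by apply: bilinear_pure; [exact: linear_id|exact: psiL].
rewrite sweedlerA // (@eq_sweedler _ _ _ _ _ _
  (fun p q => p ⊗ q - p ⊗ psi (phi q))).
  rewrite sweedlerB -tensorE -[RHS]subr0; congr (_ - _).
  transitivity (\sw_(p ⊗ t <- \sw_(p ⊗ q <- comul (b : P)) p ⊗ phi q)
      p ⊗ psi t).
    by rewrite sweedlerA //; apply: eq_sweedler => p q; rewrite sweedler_pure.
  by rewrite phi_comul; exact: (linear_0 (sweedlerP psiF)).
move=> p q; rewrite sweedler_pure //= /r -[q - _]addrC -scaleN1r.
by rewrite pure_linearr scaleN1r addrC.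
Qed.

(* The left P-coaction on B = P^H: the lift of the coproduct of P through the *)
(* injection of P ⊗ B into P ⊗ P.                                             *)
Definition coinv_coaction (b : coinvariants) : P ⊗ coinvariants :=
  projT1 (cid (coinv_coaction_subproof b)).

Lemma coinv_coactionE b :
  \sw_(p ⊗ c <- coinv_coaction b) p ⊗ coinv_val c = comul (b : P).
Proof. exact: (projT2 (cid (coinv_coaction_subproof b))). Qed.

Lemma coinv_tensor_inj :
  injective (fun s : P ⊗ coinvariants => \sw_(p ⊗ c <- s) p ⊗ coinv_val c).
Proof.
have [psi [psiL psiK]] := generalized_inverse coinv_val_linear.
have psiF : bilinear_map (fun p q : P => p ⊗ psi q).
  by apply: bilinear_pure; [exact: linear_id|exact: psiL].
apply: (can_inj (g := fun t => \sw_(p ⊗ q <- t) p ⊗ psi q)) => s.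
rewrite sweedler_map // [RHS]tensorE; apply: eq_sweedler => p c.
by congr (_ ⊗ _); apply: val_inj; exact: psiK.
Qed.

End Coinvariants.

Record category := Category {
  object :> Type;
  hom : object -> object -> Type;
  idmap : forall X, hom X X;
  compose : forall X Y Z, hom Y Z -> hom X Y -> hom X Z;
  compose1l : forall X Y (f : hom X Y), compose (idmap Y) f = f;
  compose1r : forall X Y (f : hom X Y), compose f (idmap X) = f;
  composeA : forall X Y Z T (h : hom Z T) (g : hom Y Z) (f : hom X Y),
    compose h (compose g f) = compose (compose h g) f
}.
Arguments hom {c}.
Arguments idmap {c}.
Arguments compose {c X Y Z}.

Record functor (C D : category) := Functor {
  fobj :> C -> D;
  fmap : forall X Y, hom X Y -> hom (fobj X) (fobj Y);
  fmap1 : forall X, fmap (idmap X) = idmap (fobj X);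
  fmapM : forall X Y Z (g : hom Y Z) (f : hom X Y),
    fmap (compose g f) = compose (fmap g) (fmap f)
}.
Arguments fmap {C D} f {X Y} : rename.

Definition functor_id (C : category) : functor C C :=
  @Functor C C id (fun _ _ f => f) (fun _ => erefl) (fun _ _ _ _ _ => erefl).

Section FunctorComp.
Variables (C D E : category) (G : functor D E) (F : functor C D).

Lemma functor_comp1 X : fmap G (fmap F (idmap X)) = idmap (G (F X)).
Proof. by rewrite !fmap1. Qed.

Lemma functor_compM X Y Z (g : hom Y Z) (f : hom X Y) :
  fmap G (fmap F (compose g f)) =
  compose (fmap G (fmap F g)) (fmap G (fmap F f)).
Proof. by rewrite !fmapM. Qed.

Definition functor_comp : functor C E :=
  @Functor C E (fun X => G (F X)) (fun X Y f => fmap G (fmap F f))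
    functor_comp1 functor_compM.

End FunctorComp.

Record nat_iso (C D : category) (F G : functor C D) := NatIso {
  component : forall X, hom (F X) (G X);
  component_inv : forall X, hom (G X) (F X);
  componentK : forall X,
    compose (component_inv X) (component X) = idmap (F X);
  componentVK : forall X,
    compose (component X) (component_inv X) = idmap (G X);
  naturality : forall X Y (f : hom X Y),
    compose (component Y) (fmap F f) = compose (fmap G f) (component X)
}.

Definition equivalent_categories (C D : category) : Prop :=
  exists (F : functor C D) (G : functor D C),
    inhabited (nat_iso (functor_comp G F) (functor_id C)) /\
    inhabited (nat_iso (functor_comp F G) (functor_id D)).

Section Categories.
Variables (k : fieldType) (P H : hopfAlgType k) (pi : {lrmorphism P -> H}).
Local Notation B := (coinvariants pi).

Record crossed_module := CrossedModule {
  crossed_space :> lmodType k;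
  crossed_ract : right_module B crossed_space;
  crossed_rcoact : right_comodule H crossed_space;
  crossed_condition : forall (x : crossed_space) (b : B),
    \sw_(y ⊗ h <- crossed_rcoact x) crossed_ract y b ⊗ h =
    \sw_(p ⊗ c <- coinv_coaction b)
      \sw_(y ⊗ h <- crossed_rcoact (crossed_ract x c)) y ⊗ (pi p * h)
}.

Record crossed_hom (X Y : crossed_module) := CrossedHom {
  crossed_fun :> X -> Y;
  crossed_fun_linear : linear crossed_fun;
  crossed_fun_ract : forall x b,
    crossed_fun (crossed_ract X x b) = crossed_ract Y (crossed_fun x) b;
  crossed_fun_rcoact : forall x,
    crossed_rcoact Y (crossed_fun x) =
    \sw_(y ⊗ h <- crossed_rcoact X x) crossed_fun y ⊗ h
}.

Lemma crossed_hom_eq X Y (f g : crossed_hom X Y) : f =1 g -> f = g.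
Proof.
case: f g => [f f1 f2 f3] [g g1 g2 g3] /= /funext fg; subst g.
by congr CrossedHom; exact: Prop_irrelevance.
Qed.

Lemma crossed_id_rcoact (X : crossed_module) (x : X) :
  crossed_rcoact X x = \sw_(y ⊗ h <- crossed_rcoact X x) y ⊗ h.
Proof. exact: tensorE. Qed.

Definition crossed_id (X : crossed_module) : crossed_hom X X :=
  @CrossedHom X X id (@linear_id _ X) (fun _ _ => erefl)
    (@crossed_id_rcoact X).

Section CrossedComp.
Variables (X Y Z : crossed_module).
Variables (g : crossed_hom Y Z) (f : crossed_hom X Y).

Lemma crossed_comp_linear : linear (g \o f).
Proof. exact: linear_comp (crossed_fun_linear g) (crossed_fun_linear f). Qed.

Lemma crossed_comp_ract x b :
  (g \o f) (crossed_ract X x b) = crossed_ract Z ((g \o f) x) b.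
Proof. by rewrite /= !crossed_fun_ract. Qed.

Lemma crossed_comp_rcoact x :
  crossed_rcoact Z ((g \o f) x) =
  \sw_(y ⊗ h <- crossed_rcoact X x) (g \o f) y ⊗ h.
Proof.
rewrite /= !crossed_fun_rcoact (sweedler_map _ _ id) //.
by apply: bilinear_pure; [exact: crossed_fun_linear|exact: linear_id].
Qed.

Definition crossed_comp : crossed_hom X Z :=
  CrossedHom crossed_comp_linear crossed_comp_ract crossed_comp_rcoact.

End CrossedComp.

Lemma crossed_comp1l X Y (f : crossed_hom X Y) :
  crossed_comp (crossed_id Y) f = f.
Proof. exact: crossed_hom_eq. Qed.

Lemma crossed_comp1r X Y (f : crossed_hom X Y) :
  crossed_comp f (crossed_id X) = f.
Proof. exact: crossed_hom_eq. Qed.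

Lemma crossed_compA X Y Z T (h : crossed_hom Z T) (g : crossed_hom Y Z)
    (f : crossed_hom X Y) :
  crossed_comp h (crossed_comp g f) = crossed_comp (crossed_comp h g) f.
Proof. exact: crossed_hom_eq. Qed.

(* The category written M-dot^H_B.                                            *)
Definition crossed_category : category :=
  Category crossed_comp1l crossed_comp1r crossed_compA.

Record hopf_bimodule := HopfBimodule {
  hopf_space :> lmodType k;
  hopf_lact : left_module P hopf_space;
  hopf_lcoact : left_comodule P hopf_space;
  hopf_ract : right_module B hopf_space;
  hopf_rcoact : right_comodule H hopf_space;
  hopf_actC : forall p (y : hopf_space) b,
    hopf_ract (hopf_lact p y) b = hopf_lact p (hopf_ract y b);
  hopf_coactC : forall y : hopf_space,
    \sw_(p ⊗ z <- hopf_lcoact y) p ⊗ hopf_rcoact z =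
    \sw_(z ⊗ h <- hopf_rcoact y) \sw_(p ⊗ w <- hopf_lcoact z) p ⊗ (w ⊗ h);
  hopf_lact_lcoact : forall p (y : hopf_space),
    hopf_lcoact (hopf_lact p y) =
    \sw_(p1 ⊗ p2 <- comul p) \sw_(q ⊗ z <- hopf_lcoact y)
      (p1 * q) ⊗ hopf_lact p2 z;
  hopf_ract_lcoact : forall (y : hopf_space) b,
    hopf_lcoact (hopf_ract y b) =
    \sw_(q ⊗ z <- hopf_lcoact y) \sw_(p ⊗ c <- coinv_coaction b)
      (q * p) ⊗ hopf_ract z c;
  hopf_lact_rcoact : forall p (y : hopf_space),
    hopf_rcoact (hopf_lact p y) =
    \sw_(p1 ⊗ p2 <- comul p) \sw_(z ⊗ h <- hopf_rcoact y)
      hopf_lact p1 z ⊗ (pi p2 * h);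
  hopf_ract_rcoact : forall (y : hopf_space) b,
    hopf_rcoact (hopf_ract y b) =
    \sw_(z ⊗ h <- hopf_rcoact y) hopf_ract z b ⊗ h
}.

Record hopf_bimodule_hom (X Y : hopf_bimodule) := HopfBimoduleHom {
  hopf_fun :> X -> Y;
  hopf_fun_linear : linear hopf_fun;
  hopf_fun_lact : forall p x,
    hopf_fun (hopf_lact X p x) = hopf_lact Y p (hopf_fun x);
  hopf_fun_lcoact : forall x,
    hopf_lcoact Y (hopf_fun x) =
    \sw_(p ⊗ y <- hopf_lcoact X x) p ⊗ hopf_fun y;
  hopf_fun_ract : forall x b,
    hopf_fun (hopf_ract X x b) = hopf_ract Y (hopf_fun x) b;
  hopf_fun_rcoact : forall x,
    hopf_rcoact Y (hopf_fun x) =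
    \sw_(y ⊗ h <- hopf_rcoact X x) hopf_fun y ⊗ h
}.

Lemma hopf_bimodule_hom_eq X Y (f g : hopf_bimodule_hom X Y) :
  f =1 g -> f = g.
Proof.
case: f g => [f f1 f2 f3 f4 f5] [g g1 g2 g3 g4 g5] /= /funext fg; subst g.
by congr HopfBimoduleHom; exact: Prop_irrelevance.
Qed.

Definition hopf_bimodule_id (X : hopf_bimodule) : hopf_bimodule_hom X X :=
  @HopfBimoduleHom X X id (@linear_id _ X) (fun _ _ => erefl)
    (fun x => tensorE _) (fun _ _ => erefl) (fun x => tensorE _).

Section HopfBimoduleComp.
Variables (X Y Z : hopf_bimodule).
Variables (g : hopf_bimodule_hom Y Z) (f : hopf_bimodule_hom X Y).

Lemma hopf_comp_linear : linear (g \o f).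
Proof. exact: linear_comp (hopf_fun_linear g) (hopf_fun_linear f). Qed.

Lemma hopf_comp_lact p x :
  (g \o f) (hopf_lact X p x) = hopf_lact Z p ((g \o f) x).
Proof. by rewrite /= !hopf_fun_lact. Qed.

Lemma hopf_comp_lcoact x :
  hopf_lcoact Z ((g \o f) x) =
  \sw_(p ⊗ y <- hopf_lcoact X x) p ⊗ (g \o f) y.
Proof.
rewrite /= !hopf_fun_lcoact (sweedler_map _ id) //.
by apply: bilinear_pure; [exact: linear_id|exact: hopf_fun_linear].
Qed.

Lemma hopf_comp_ract x b :
  (g \o f) (hopf_ract X x b) = hopf_ract Z ((g \o f) x) b.
Proof. by rewrite /= !hopf_fun_ract. Qed.

Lemma hopf_comp_rcoact x :
  hopf_rcoact Z ((g \o f) x) =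
  \sw_(y ⊗ h <- hopf_rcoact X x) (g \o f) y ⊗ h.
Proof.
rewrite /= !hopf_fun_rcoact (sweedler_map _ _ id) //.
by apply: bilinear_pure; [exact: hopf_fun_linear|exact: linear_id].
Qed.

Definition hopf_bimodule_comp : hopf_bimodule_hom X Z :=
  HopfBimoduleHom hopf_comp_linear hopf_comp_lact hopf_comp_lcoact
    hopf_comp_ract hopf_comp_rcoact.

End HopfBimoduleComp.

Lemma hopf_bimodule_comp1l X Y (f : hopf_bimodule_hom X Y) :
  hopf_bimodule_comp (hopf_bimodule_id Y) f = f.
Proof. exact: hopf_bimodule_hom_eq. Qed.

Lemma hopf_bimodule_comp1r X Y (f : hopf_bimodule_hom X Y) :
  hopf_bimodule_comp f (hopf_bimodule_id X) = f.
Proof. exact: hopf_bimodule_hom_eq. Qed.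

Lemma hopf_bimodule_compA X Y Z T (h : hopf_bimodule_hom Z T)
    (g : hopf_bimodule_hom Y Z) (f : hopf_bimodule_hom X Y) :
  hopf_bimodule_comp h (hopf_bimodule_comp g f) =
  hopf_bimodule_comp (hopf_bimodule_comp h g) f.
Proof. exact: hopf_bimodule_hom_eq. Qed.

(* The category written ^P_P M^H_B.                                           *)
Definition hopf_bimodule_category : category :=
  Category hopf_bimodule_comp1l hopf_bimodule_comp1r hopf_bimodule_compA.

End Categories.

(* Main.v *)
Require Import Defs.
From HB Require Import structures.
From mathcomp Require Import all_boot all_order all_algebra.

(* A crossed module X goes to the free Hopf module P ⊗ X; a Hopf bimodule Y   *)
(* goes to its space of left P-coinvariants. The structure theorem of Hopf    *)
(* modules makes these inverse to each other: Pi y = S(y_1) |> y_2 projects Y *)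
(* onto its coinvariants, and y = y_1 |> Pi(y_2). On coinvariants B acts by   *)
(* x.b = Pi(x <| b), which is characterized by x <| b = b_1 |> x.b_2, and H   *)
(* coacts by restriction. The crossed condition on X is what makes the        *)
(* diagonal coaction of H on P ⊗ X commute with the diagonal action of B.     *)
(* All identities on coinvariants follow from one principle: linear maps f, g *)
(* on a P-comodule with v_1 |> f(v_2) = v_1 |> g(v_2) coincide, since f is    *)
(* recovered by applying S(v_1). Hence the antipode is only used as a         *)
(* convolution inverse; that it reverses products and coproducts is not       *)
(* needed.                                                                    *)

Set Implicit Arguments.
Unset Strict Implicit.
Unset Printing Implicit Defensive.

Import GRing.Theory.
Local Open Scope ring_scope.

(** * Sweedler calculus *)

(** The equivalence is carried by two natural maps: x ↦ 1 ⊗ x from X to the coinvariants of P ⊗ X,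
    and p ⊗ z ↦ p |> z from P ⊗ C to Y, where C is the space of left coinvariants of Y. Both are
    bijective. For the second this is the fundamental theorem of Hopf modules: by [lcoinv_projK] and
    [lcoinv_proj_lact] its inverse is y ↦ y_1 ⊗ Pi(y_2). For the first, applying the counit to the
    coinvariance equation shows that a coinvariant of P ⊗ X lies in 1 ⊗ X ([unit_invK]).

    The rest is the matching of the structures of B and H. [free_ract_rcoact] turns the crossed
    condition on X into the compatibility of B-action and H-coaction on P ⊗ X. Conversely,
    [lcoinv_crossed] computes the H-coaction of x <| b in two ways: directly, and through x <| b =
    b_1 |> x.b_2 ([lcoinv_ractE]), where the action of P contributes the factor with [pi]. Comparing
    the results by [coaction_cancel] gives the crossed condition on C.

    Over a field, tensoring preserves injectivity ([tensor_injl], [tensor_injr]). Hence identities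
    in C ⊗ H may be checked in Y ⊗ H, and those for the coaction of B in tensor powers of P. *)

Section Multilinear.
Variables (k : fieldType).
Implicit Types U V W X : lmodType k.

Definition trilinear_map U V W X (F : U -> V -> W -> X) :=
  [/\ forall v w, linear (fun u => F u v w),
      forall u w, linear (fun v => F u v w) &
      forall u v, linear (fun w => F u v w)].

Lemma linear_scaler U V (f : U -> V) (a : k) :
  linear f -> linear (fun u => a *: f u).
Proof. by move=> fL b u v; rewrite fL scalerDr !scalerA mulrC. Qed.

Lemma linear_homo U V (f : U -> V) a u : linear f -> f (a *: u) = a *: f u.
Proof. by move=> fL; rewrite -[a *: u]addr0 fL (linear_0 fL) addr0. Qed.

Lemma linear_form_scale U V W (e : {scalar V}) (f : U -> V) (w : W) :
  linear f -> linear (fun u => e (f u) *: w).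
Proof. by move=> fL b u v; rewrite fL linearP scalerDl scalerA. Qed.

Lemma linear_mull (A : algType k) U (f : U -> A) (a : A) :
  linear f -> linear (fun u => f u * a).
Proof. by move=> fL b u v; rewrite fL mulrDl scalerAl. Qed.

Lemma linear_mulr (A : algType k) U (f : U -> A) (a : A) :
  linear f -> linear (fun u => a * f u).
Proof. by move=> fL b u v; rewrite fL mulrDr scalerAr. Qed.

(** A Sweedler sum is a finite sum over a chosen representative, so this is an interchange of finite
    sums, valid for arbitrary [F]. *)
Lemma sweedler_exchange U V U' V' X (s : U ⊗ V) (t : U' ⊗ V')
    (F : U -> V -> U' -> V' -> X) :
  \sw_(a ⊗ b <- s) \sw_(c ⊗ d <- t) F a b c d =
  \sw_(c ⊗ d <- t) \sw_(a ⊗ b <- s) F a b c d.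
Proof. exact: exchange_big. Qed.

(** Over a field an injective linear map has a linear retraction, and the retraction survives
    tensoring. *)
Lemma tensor_injr U V W (f : V -> W) : linear f -> injective f ->
  injective (fun t : U ⊗ V => \sw_(u ⊗ v <- t) u ⊗ f v).
Proof.
move=> fL fI; have [g [gL gK]] := generalized_inverse fL.
have gF : bilinear_map (fun (u : U) w => u ⊗ g w).
  by apply: bilinear_pure; [exact: linear_id|].
apply: (can_inj (g := fun t => \sw_(u ⊗ w <- t) u ⊗ g w)) => t.
rewrite sweedler_map // [RHS]tensorE; apply: eq_sweedler => u v.
by congr (_ ⊗ _); apply: fI.
Qed.

Lemma tensor_injl U V W (f : V -> W) : linear f -> injective f ->
  injective (fun t : V ⊗ U => \sw_(v ⊗ u <- t) f v ⊗ u).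
Proof.
move=> fL fI; have [g [gL gK]] := generalized_inverse fL.
have gF : bilinear_map (fun w (u : U) => g w ⊗ u).
  by apply: bilinear_pure; [|exact: linear_id].
apply: (can_inj (g := fun t => \sw_(w ⊗ u <- t) g w ⊗ u)) => t.
rewrite (sweedler_map _ _ id) // [RHS]tensorE; apply: eq_sweedler => v u.
by congr (_ ⊗ _); apply: fI.
Qed.

End Multilinear.

(* Linearity of the maps of the current context, redefined as they appear.    *)
Ltac lin_hyp := fail.

(* Proves linearity by recursion on the body. Subterms are matched as         *)
(* functions of the variable, so that independence of it can be tested.       *)
Ltac lin :=
  cbv beta;
  lazymatch goal with
  | |- bilinear_map ?F => split; intro; lin
  | |- trilinear_map ?F => split; intros ? ?; lin
  | |- forall _, _ => intro; lin
  | |- GRing.linear_for _ ?f => lin_step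
  end
with lin_step :=
  tryif assumption then idtac else
  tryif exact: linear_id then idtac else
  lazymatch goal with
  | |- GRing.linear_for _ (fun x => sweedler (@?t x) (@?F x)) =>
      lazymatch t with
      | fun _ => ?t0 =>
          refine (@linear_sweedlerF _ _ _ _ _ t0 F _); intros; lin
      | _ => lazymatch F with
             | fun _ => ?F0 =>
                 refine (@linear_sweedler _ _ _ _ _ t F0 _ _); lin
             end
      end
  | |- GRing.linear_for _ (fun x => GRing.scale (@?c x) (@?f x)) =>
      lazymatch c with
      | fun _ => ?a => refine (@linear_scaler _ _ _ f a _); lin
      | fun x => _ (@?c0 x) =>
          lazymatch f with
          | fun _ => ?w => refine (@linear_form_scale _ _ _ _ _ c0 w _); lin
          end
      end
  | |- GRing.linear_for _ (fun x => pure (@?f x) (@?g x)) =>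
      lazymatch g with
      | fun _ => ?w => refine (@linear_pure _ _ _ _ f w _); lin
      | _ => lazymatch f with
             | fun _ => ?w => refine (@linear_purer _ _ _ _ g w _); lin
             end
      end
  | |- GRing.linear_for _ (fun x => GRing.mul (@?f x) (@?g x)) =>
      lazymatch g with
      | fun _ => ?w => refine (@linear_mull _ _ _ f w _); lin
      | _ => lazymatch f with
             | fun _ => ?w => refine (@linear_mulr _ _ _ g w _); lin
             end
      end
  | |- GRing.linear_for _ (fun x => lact ?m (@?f x) (@?g x)) =>
      lazymatch g with
      | fun _ => ?w =>
          refine (linear_comp ((lact_bilinear m).1 w) (g := f) _); lin
      | _ => lazymatch f with
             | fun _ => ?w =>
                 refine (linear_comp ((lact_bilinear m).2 w) (g := g) _); lin
             end
      end
  | |- GRing.linear_for _ (fun x => ract ?m (@?f x) (@?g x)) =>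
      lazymatch g with
      | fun _ => ?w =>
          refine (linear_comp ((ract_bilinear m).1 w) (g := f) _); lin
      | _ => lazymatch f with
             | fun _ => ?w =>
                 refine (linear_comp ((ract_bilinear m).2 w) (g := g) _); lin
             end
      end
  | |- GRing.linear_for _ (fun x => lcoact ?m (@?f x)) =>
      refine (linear_comp (lcoact_linear m) (g := f) _); lin
  | |- GRing.linear_for _ (fun x => rcoact ?m (@?f x)) =>
      refine (linear_comp (rcoact_linear m) (g := f) _); lin
  | |- GRing.linear_for _ (fun x => coinv_val (@?f x)) =>
      refine (linear_comp (@coinv_val_linear _ _ _ _) (g := f) _); lin
  | H : trilinear_map ?G
    |- GRing.linear_for _ (fun x => ?G (@?f x) (@?g x) (@?h x)) =>
      let T := fresh in
      lazymatch constr:((f, g, h)) with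
      | (_, fun _ => ?v, fun _ => ?w) =>
          have [T _ _] := H; refine (linear_comp (T v w) (g := f) _)
      | (fun _ => ?u, _, fun _ => ?w) =>
          have [_ T _] := H; refine (linear_comp (T u w) (g := g) _)
      | (fun _ => ?u, fun _ => ?v, _) =>
          have [_ _ T] := H; refine (linear_comp (T u v) (g := h) _)
      end; clear T; lin
  | H : bilinear_map ?G |- GRing.linear_for _ (fun x => ?G (@?f x) (@?g x)) =>
      lazymatch constr:((f, g)) with
      | (_, fun _ => ?w) => refine (linear_comp (H.1 w) (g := f) _); lin
      | (fun _ => ?w, _) => refine (linear_comp (H.2 w) (g := g) _); lin
      end
  | |- GRing.linear_for _ (fun x => ?g (@?f x)) =>
      refine (linear_comp (f := g) (g := f) _ _);
      [ first [ assumption | exact: linearP | lin_hyp ] | lin ]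
  | |- GRing.linear_for _ ?g =>
      first [ assumption | exact: linearP | lin_hyp ]
  end.

(* Pulls a Sweedler sum out of the linear context around it; iterated, this   *)
(* brings the left-hand side to prenex form.                                  *)
Ltac sw_step :=
  cbv beta;
  lazymatch goal with
  | |- sweedler ?t ?F = _ =>
      lazymatch t with
      | pure ?v ?w =>
          eapply eq_trans; [refine (@sweedler_pure _ _ _ _ F v w _); lin|]
      | context C [sweedler ?s ?G] =>
          let T := type of (sweedler s G) in
          let z := fresh in
          let f := constr:(fun z : T =>
            ltac:(let r := context C [z] in exact (sweedler r F))) in
          eapply eq_trans; [refine (@linear_sw _ _ _ _ _ f s G _); lin|]
      end
  | |- ?L = _ =>
      lazymatch L with
      | context C [sweedler ?s ?G] =>
          let T := type of (sweedler s G) in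
          let z := fresh in
          let f := constr:(fun z : T =>
            ltac:(let r := context C [z] in exact r)) in
          eapply eq_trans; [refine (@linear_sw _ _ _ _ _ f s G _); lin|]
      end
  end.

(** Hoists sums until one is outermost, then descends under its binders. The closing [reflexivity]
    either checks the right-hand side or, when that is an existential variable, fills it with the
    prenex form. *)
Ltac sw_nf :=
  repeat sw_step; cbv beta;
  lazymatch goal with
  | |- sweedler ?t ?F = _ =>
      refine (@eq_sweedler _ _ _ _ t F _ _);
      let a := fresh "a" in let b := fresh "b" in
      intros a b; sw_nf
  | |- _ => reflexivity
  end.

Ltac sw_l := eapply eq_trans; [sw_nf|].
Ltac sw_r := apply/esym; sw_l; apply/esym.
Ltac sw := sw_l; sw_r.

(** Closes a goal whose two sides are the prenex forms of the two sides of [E]. *)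
Ltac sw_from E := refine (eq_trans (esym _) (eq_trans E _)); sw_nf.

(** * Coassociativity and counit axioms under multilinear maps *)

Section Coassociativity.
Variables (k : fieldType) (A : hopfAlgType k).

(** A trilinear [F] factors through the triple tensor product; the induced map is evaluated at both
    sides of [comulA]. The versions for comodules below arise in the same way. *)
Lemma sweedler_comulA (U : lmodType k) (F : A -> A -> A -> U) h :
  trilinear_map F ->
  \sw_(a ⊗ b <- comul h) \sw_(c ⊗ d <- comul b) F a c d =
  \sw_(a ⊗ b <- comul h) \sw_(c ⊗ d <- comul a) F c d b.
Proof.
move=> FL.
have /(congr1 (fun t => \sw_(a ⊗ s <- t) \sw_(c ⊗ d <- s) F a c d)) :=
  comulA h.
by move=> E; sw_from E.
Qed.

Lemma sweedler_lcoactA (V U : lmodType k) (m : left_comodule A V)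
    (F : A -> A -> V -> U) x :
  trilinear_map F ->
  \sw_(a ⊗ v <- m x) \sw_(b ⊗ w <- m v) F a b w =
  \sw_(a ⊗ v <- m x) \sw_(c ⊗ d <- comul a) F c d v.
Proof.
move=> FL.
have /(congr1 (fun t => \sw_(a ⊗ s <- t) \sw_(c ⊗ d <- s) F a c d)) :=
  lcoactA m x.
by move=> E; sw_from E.
Qed.

Lemma sweedler_rcoactA (V U : lmodType k) (m : right_comodule A V)
    (F : V -> A -> A -> U) x :
  trilinear_map F ->
  \sw_(v ⊗ a <- m x) \sw_(w ⊗ b <- m v) F w b a =
  \sw_(v ⊗ a <- m x) \sw_(c ⊗ d <- comul a) F v c d.
Proof.
move=> FL.
have /(congr1 (fun t => \sw_(a ⊗ s <- t) \sw_(c ⊗ d <- s) F a c d)) :=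
  rcoactA m x.
by move=> E; apply: esym; sw_from E.
Qed.

Lemma sweedler_counitl (U : lmodType k) (F : A -> U) h :
  linear F -> \sw_(a ⊗ b <- comul h) counit a *: F b = F h.
Proof.
move=> FL; rewrite -[in RHS](counitl h) (linear_sw _ _ FL).
by apply: eq_sweedler => a b; rewrite (linear_homo _ _ FL).
Qed.

Lemma sweedler_counitr (U : lmodType k) (F : A -> U) h :
  linear F -> \sw_(a ⊗ b <- comul h) counit b *: F a = F h.
Proof.
move=> FL; rewrite -[in RHS](counitr h) (linear_sw _ _ FL).
by apply: eq_sweedler => a b; rewrite (linear_homo _ _ FL).
Qed.

Lemma sweedler_lcounit (V U : lmodType k) (m : left_comodule A V)
    (F : V -> U) x :
  linear F -> \sw_(a ⊗ v <- m x) counit a *: F v = F x.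
Proof.
move=> FL; rewrite -[in RHS](lcoact_counit m x) (linear_sw _ _ FL).
by apply: eq_sweedler => a b; rewrite (linear_homo _ _ FL).
Qed.

Lemma sweedler_rcounit (V U : lmodType k) (m : right_comodule A V)
    (F : V -> U) x :
  linear F -> \sw_(v ⊗ a <- m x) counit a *: F v = F x.
Proof.
move=> FL; rewrite -[in RHS](rcoact_counit m x) (linear_sw _ _ FL).
by apply: eq_sweedler => a b; rewrite (linear_homo _ _ FL).
Qed.

End Coassociativity.

(** * The left P-comodule algebra B *)

Section CoinvariantsComodule.
Variables (k : fieldType) (P H : hopfAlgType k) (pi : {lrmorphism P -> H}).
Local Notation B := (coinvariants pi).

Lemma coinv_val_inj : injective (@coinv_val k P H pi).
Proof. exact: val_inj. Qed.

(** The coaction of B lifts the coproduct of P, so a bilinear map that sees the leg in B only as an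
    element of P cannot distinguish the two. *)
Lemma sweedler_coinv (U : lmodType k) (F : P -> P -> U) (b : B) :
  bilinear_map F ->
  \sw_(p ⊗ c <- coinv_coaction b) F p (c : P) =
  \sw_(p ⊗ q <- comul (b : P)) F p q.
Proof. by move=> FL; rewrite -coinv_coactionE; sw_r. Qed.

(** The coaction is a lift obtained by choice, but P ⊗ B embeds in P ⊗ P, so the lift is unique and
    inherits linearity from the coproduct. Coassociativity and multiplicativity are transported
    likewise. *)
Lemma coinv_coaction_linear : linear (@coinv_coaction k P H pi).
Proof.
move=> a b c; apply: coinv_tensor_inj => /=.
rewrite coinv_coactionE (sweedlerP (F := fun p (c : B) => p ⊗ (c : P)));
  last by lin.
by rewrite !coinv_coactionE linearP.
Qed.

Ltac lin_hyp ::= exact: coinv_coaction_linear.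

Lemma coinv_coactionA (b : B) :
  \sw_(p ⊗ c <- coinv_coaction b) p ⊗ coinv_coaction c =
  \sw_(p ⊗ c <- coinv_coaction b) \sw_(d ⊗ e <- comul p) d ⊗ (e ⊗ c).
Proof.
apply: (tensor_injr (f := fun s : P ⊗ B => \sw_(p ⊗ c <- s) p ⊗ (c : P))).
- by lin.
- exact: coinv_tensor_inj.
transitivity (\sw_(p ⊗ q <- comul (b : P)) p ⊗ comul q).
  rewrite -sweedler_coinv; last by lin.
  by sw_l; apply: eq_sweedler => p c; rewrite -coinv_coactionE; sw_r.
rewrite comulA -sweedler_coinv; last by lin.
by sw_r.
Qed.

Lemma coinv_coaction_counit (b : B) :
  \sw_(p ⊗ c <- coinv_coaction b) counit p *: c = b.
Proof.
apply: coinv_val_inj; rewrite (linear_sw _ _ (@coinv_val_linear _ _ _ pi)) /=.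
transitivity (\sw_(p ⊗ c <- coinv_coaction b) counit p *: (c : P)) => //.
rewrite (sweedler_coinv (F := fun p q => counit p *: q)); last by lin.
exact: counitl.
Qed.

Definition coinv_comodule : left_comodule P B :=
  LeftComodule coinv_coaction_linear coinv_coactionA coinv_coaction_counit.

Lemma coinv_coaction1 : coinv_coaction (1 : B) = 1 ⊗ 1.
Proof.
apply: coinv_tensor_inj => /=.
rewrite coinv_coactionE sweedler_pure; last by lin.
exact: comul1.
Qed.

Lemma coinv_coactionM (b c : B) : coinv_coaction (b * c) =
  \sw_(p ⊗ d <- coinv_coaction b) \sw_(q ⊗ e <- coinv_coaction c)
    (p * q) ⊗ (d * e).
Proof.
apply: coinv_tensor_inj => /=; rewrite coinv_coactionE comulM; sw_r.
rewrite -sweedler_coinv; last by lin.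
by apply: eq_sweedler => p d; rewrite -sweedler_coinv; last by lin.
Qed.

Lemma sweedler_coinvA (U : lmodType k) (F : P -> P -> B -> U) (b : B) :
  trilinear_map F ->
  \sw_(p ⊗ c <- coinv_coaction b) \sw_(q ⊗ d <- coinv_coaction c) F p q d =
  \sw_(p ⊗ c <- coinv_coaction b) \sw_(q ⊗ d <- comul p) F q d c.
Proof. exact: (sweedler_lcoactA coinv_comodule). Qed.

Lemma sweedler_coinv_counit (U : lmodType k) (F : B -> U) (b : B) :
  linear F -> \sw_(p ⊗ c <- coinv_coaction b) counit p *: F c = F b.
Proof. exact: (sweedler_lcounit coinv_comodule). Qed.

End CoinvariantsComodule.

(** * The free Hopf bimodule on a crossed module *)

Section FreeBimodule.
Variables (k : fieldType) (P H : hopfAlgType k) (pi : {lrmorphism P -> H}).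
Hypothesis pi_hopf : hopf_morphism pi.
Local Notation B := (coinvariants pi).

Lemma hopf_morphism_comul p : comul (pi p) = \sw_(a ⊗ b <- comul p) pi a ⊗ pi b.
Proof. by case: pi_hopf. Qed.

Lemma hopf_morphism_counit p : counit (pi p) = counit p.
Proof. by case: pi_hopf. Qed.

Section Object.
Variable X : crossed_module pi.
Local Notation V := (P ⊗ X)%type.

Definition free_lact (q : P) (t : V) : V := \sw_(p ⊗ x <- t) (q * p) ⊗ x.

Definition free_lcoact (t : V) : P ⊗ V :=
  \sw_(p ⊗ x <- t) \sw_(a ⊗ b <- comul p) a ⊗ (b ⊗ x).

Definition free_ract (t : V) (b : B) : V :=
  \sw_(p ⊗ x <- t) \sw_(q ⊗ c <- coinv_coaction b) (p * q) ⊗ crossed_ract X x c.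

Definition free_rcoact (t : V) : V ⊗ H :=
  \sw_(p ⊗ x <- t) \sw_(a ⊗ b <- comul p) \sw_(y ⊗ h <- crossed_rcoact X x)
    (a ⊗ y) ⊗ (pi b * h).

Lemma free_lact_bilinear : bilinear_map free_lact.
Proof. by rewrite /free_lact; lin. Qed.

Lemma free_lact1 t : free_lact 1 t = t.
Proof.
by rewrite [RHS]tensorE; apply: eq_sweedler => p x; rewrite mul1r.
Qed.

Lemma free_lactM a b t : free_lact (a * b) t = free_lact a (free_lact b t).
Proof.
by rewrite /free_lact; sw_r; apply: eq_sweedler => p x; rewrite mulrA.
Qed.

Definition free_left_module : left_module P V :=
  LeftModule free_lact_bilinear free_lact1 free_lactM.

Lemma free_lcoact_linear : linear free_lcoact.
Proof. by rewrite /free_lcoact; lin. Qed.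

Lemma free_lcoactA t :
  \sw_(c ⊗ v <- free_lcoact t) c ⊗ free_lcoact v =
  \sw_(c ⊗ v <- free_lcoact t) \sw_(d ⊗ e <- comul c) d ⊗ (e ⊗ v).
Proof.
rewrite /free_lcoact; sw; apply: eq_sweedler => p x.
by apply: (sweedler_comulA (F := fun a b c => a ⊗ (b ⊗ (c ⊗ x)))); lin.
Qed.

Lemma free_lcoact_counit t :
  \sw_(c ⊗ v <- free_lcoact t) counit c *: v = t.
Proof.
rewrite /free_lcoact [RHS]tensorE; sw_l; apply: eq_sweedler => p x.
by apply: (sweedler_counitl (F := fun a => a ⊗ x)); lin.
Qed.

Definition free_left_comodule : left_comodule P V :=
  LeftComodule free_lcoact_linear free_lcoactA free_lcoact_counit.

Ltac lin_hyp ::= exact: coinv_coaction_linear.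

Lemma free_ract_bilinear : bilinear_map free_ract.
Proof. by rewrite /free_ract; lin. Qed.

Lemma free_ract1 t : free_ract t 1 = t.
Proof.
rewrite /free_ract [RHS]tensorE; apply: eq_sweedler => p x.
by rewrite coinv_coaction1 sweedler_pure ?mulr1 ?ract1 //; lin.
Qed.

Lemma free_ractM t b c : free_ract t (b * c) = free_ract (free_ract t b) c.
Proof.
rewrite /free_ract; sw_r; apply: eq_sweedler => p x.
rewrite coinv_coactionM; sw_l; apply: eq_sweedler => q d.
by apply: eq_sweedler => q' e; rewrite mulrA ractM.
Qed.

Definition free_right_module : right_module B V :=
  RightModule free_ract_bilinear free_ract1 free_ractM.

Lemma free_rcoact_linear : linear free_rcoact.
Proof. by rewrite /free_rcoact; lin. Qed.

(** Once [pi] is moved through the coproduct, coassociativity of P and that of X apply to separate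
    legs. *)
Lemma free_rcoactA t :
  \sw_(v ⊗ c <- free_rcoact t) v ⊗ comul c =
  \sw_(v ⊗ c <- free_rcoact t) \sw_(w ⊗ d <- free_rcoact v) w ⊗ (d ⊗ c).
Proof.
rewrite /free_rcoact; sw; apply: eq_sweedler => p x.
transitivity (\sw_(a ⊗ b <- comul p) \sw_(c ⊗ d <- comul b)
  \sw_(y ⊗ h <- crossed_rcoact X x) \sw_(e ⊗ f <- comul h)
    (a ⊗ y) ⊗ ((pi c * e) ⊗ (pi d * f))).
  apply: eq_sweedler => a b; rewrite sweedler_exchange.
  apply: eq_sweedler => y h; rewrite comulM hopf_morphism_comul.
  by sw_l.
rewrite sweedler_comulA; last by lin.
apply: eq_sweedler => a b; rewrite [RHS]sweedler_exchange.
apply: eq_sweedler => c d; rewrite -sweedler_rcoactA //.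
by lin.
Qed.

Lemma free_rcoact_counit t :
  \sw_(v ⊗ c <- free_rcoact t) counit c *: v = t.
Proof.
rewrite /free_rcoact [RHS]tensorE; sw_l; apply: eq_sweedler => p x.
rewrite -[RHS](sweedler_counitr (F := fun a => a ⊗ x)); last by lin.
apply: eq_sweedler => a b.
rewrite -[RHS](sweedler_rcounit (crossed_rcoact X)
  (F := fun y => counit b *: (a ⊗ y))); last by lin.
apply: eq_sweedler => y h.
by rewrite counitM hopf_morphism_counit scalerA mulrC.
Qed.

Definition free_right_comodule : right_comodule H V :=
  RightComodule free_rcoact_linear free_rcoactA free_rcoact_counit.

Lemma free_actC p t b :
  free_ract (free_lact p t) b = free_lact p (free_ract t b).
Proof.
rewrite /free_ract /free_lact; sw; apply: eq_sweedler => q x.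
by apply: eq_sweedler => r c; rewrite mulrA.
Qed.

(** Both sides are p_1 ⊗ ((p_2 ⊗ x_1) ⊗ pi(p_3) x_2), up to coassociativity of P. *)
Lemma free_coactC t :
  \sw_(p ⊗ v <- free_lcoact t) p ⊗ free_rcoact v =
  \sw_(v ⊗ h <- free_rcoact t) \sw_(p ⊗ w <- free_lcoact v) p ⊗ (w ⊗ h).
Proof.
rewrite /free_lcoact /free_rcoact; sw; apply: eq_sweedler => p x.
rewrite sweedler_comulA; last by lin.
by apply: eq_sweedler => a b; rewrite sweedler_exchange.
Qed.

Lemma free_lact_lcoact p t :
  free_lcoact (free_lact p t) =
  \sw_(p1 ⊗ p2 <- comul p) \sw_(q ⊗ v <- free_lcoact t)
    (p1 * q) ⊗ free_lact p2 v.
Proof.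
rewrite /free_lcoact /free_lact; sw.
rewrite [RHS]sweedler_exchange; apply: eq_sweedler => q x.
by rewrite comulM; sw_l.
Qed.

(** Both sides are p_1 b_1 ⊗ (p_2 b_2 ⊗ x <| b_3), by coassociativity of the coaction on B. *)
Lemma free_ract_lcoact t b :
  free_lcoact (free_ract t b) =
  \sw_(q ⊗ v <- free_lcoact t) \sw_(p ⊗ c <- coinv_coaction b)
    (q * p) ⊗ free_ract v c.
Proof.
rewrite /free_lcoact /free_ract; sw; apply: eq_sweedler => p x.
rewrite [LHS](_ : _ = \sw_(q ⊗ c <- coinv_coaction b)
  \sw_(e ⊗ f <- comul q) \sw_(a ⊗ d <- comul p) 
    (a * e) ⊗ ((d * f) ⊗ crossed_ract X x c)); last first.
  by apply: eq_sweedler => q c; rewrite comulM sweedler_exchange; sw_l.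
rewrite -sweedler_coinvA; last by lin.
rewrite [RHS]sweedler_exchange; apply: eq_sweedler => q c.
by rewrite [RHS]sweedler_exchange.
Qed.

Lemma free_lact_rcoact p t :
  free_rcoact (free_lact p t) =
  \sw_(p1 ⊗ p2 <- comul p) \sw_(v ⊗ h <- free_rcoact t)
    free_lact p1 v ⊗ (pi p2 * h).
Proof.
rewrite /free_rcoact /free_lact; sw.
rewrite [RHS]sweedler_exchange; apply: eq_sweedler => q x.
rewrite comulM; sw_l; apply: eq_sweedler => a b; apply: eq_sweedler => c d.
by apply: eq_sweedler => y h; rewrite rmorphM mulrA.
Qed.

(** This is where the crossed condition on X enters: it absorbs the factor pi(b_2) that the diagonal
    coaction creates. *)
Lemma free_ract_rcoact t b :
  free_rcoact (free_ract t b) =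
  \sw_(v ⊗ h <- free_rcoact t) free_ract v b ⊗ h.
Proof.
rewrite /free_rcoact /free_ract; sw; apply: eq_sweedler => p x.
transitivity (\sw_(q ⊗ c <- coinv_coaction b) \sw_(e ⊗ f <- comul q)
  \sw_(a ⊗ d <- comul p) \sw_(y ⊗ h <- crossed_rcoact X (crossed_ract X x c))
    ((a * e) ⊗ y) ⊗ (pi d * (pi f * h))).
  apply: eq_sweedler => q c; rewrite comulM; sw_l.
  rewrite sweedler_exchange; apply: eq_sweedler => e f.
  apply: eq_sweedler => a d.
  by apply: eq_sweedler => y h; rewrite rmorphM mulrA.
(* Coassociativity regroups the last two legs of b as the coaction of a single element c of B, so
   that the inner sum becomes the right-hand side of [crossed_condition] for x and c. *)
rewrite -sweedler_coinvA; last by lin.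
transitivity (\sw_(q ⊗ c <- coinv_coaction b) \sw_(a ⊗ d <- comul p)
  \sw_(y ⊗ h <- \sw_(e ⊗ f <- coinv_coaction c)
    \sw_(y ⊗ h <- crossed_rcoact X (crossed_ract X x f)) y ⊗ (pi e * h))
    ((a * q) ⊗ y) ⊗ (pi d * h)).
  by apply: eq_sweedler => q c; rewrite sweedler_exchange; sw_r.
rewrite sweedler_exchange; apply: eq_sweedler => a d.
rewrite [RHS]sweedler_exchange; apply: eq_sweedler => q c.
by rewrite -crossed_condition; sw_l.
Qed.

Definition free_bimodule : hopf_bimodule pi :=
  @HopfBimodule k P H pi V free_left_module free_left_comodule
    free_right_module free_right_comodule free_actC free_coactC
    free_lact_lcoact free_ract_lcoact free_lact_rcoact free_ract_rcoact.

End Object.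

(** * Functoriality of the free bimodule *)

Section Morphism.
Variables (X Y : crossed_module pi) (f : crossed_hom X Y).

Definition free_map (t : P ⊗ X) : P ⊗ Y := \sw_(p ⊗ x <- t) p ⊗ f x.

Ltac lin_hyp ::=
  first [exact: coinv_coaction_linear | exact: crossed_fun_linear].

Lemma free_map_linear : linear free_map.
Proof. by rewrite /free_map; lin. Qed.

Lemma free_map_lact p t : free_map (free_lact p t) = free_lact p (free_map t).
Proof. by rewrite /free_map /free_lact; sw. Qed.

Lemma free_map_lcoact t :
  free_lcoact (free_map t) = \sw_(p ⊗ v <- free_lcoact t) p ⊗ free_map v.
Proof. by rewrite /free_map /free_lcoact; sw. Qed.

Lemma free_map_ract t b : free_map (free_ract t b) = free_ract (free_map t) b.
Proof.
rewrite /free_map /free_ract; sw; apply: eq_sweedler => p x.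
by apply: eq_sweedler => q c; rewrite crossed_fun_ract.
Qed.

Lemma free_map_rcoact t :
  free_rcoact (free_map t) = \sw_(v ⊗ h <- free_rcoact t) free_map v ⊗ h.
Proof.
rewrite /free_map /free_rcoact; sw; apply: eq_sweedler => p x.
by apply: eq_sweedler => a b; rewrite crossed_fun_rcoact; sw_l.
Qed.

Definition free_hom : hopf_bimodule_hom (free_bimodule X) (free_bimodule Y) :=
  @HopfBimoduleHom _ _ _ _ (free_bimodule X) (free_bimodule Y) free_map
    free_map_linear free_map_lact free_map_lcoact free_map_ract free_map_rcoact.

End Morphism.

Lemma free_hom1 X :
  free_hom (crossed_id X) = hopf_bimodule_id (free_bimodule X).
Proof. by apply: hopf_bimodule_hom_eq => t; rewrite /= /free_map -tensorE. Qed.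

Lemma free_homM X Y Z (g : crossed_hom Y Z) (f : crossed_hom X Y) :
  free_hom (crossed_comp g f) = hopf_bimodule_comp (free_hom g) (free_hom f).
Proof.
apply: hopf_bimodule_hom_eq => t; rewrite /= /free_map sweedler_map //.
by apply: bilinear_pure; [exact: linear_id|exact: crossed_fun_linear].
Qed.

Definition free_functor :
    functor (crossed_category pi) (hopf_bimodule_category pi) :=
  @Functor (crossed_category pi) (hopf_bimodule_category pi)
    free_bimodule free_hom free_hom1 free_homM.

End FreeBimodule.

(** * Left coinvariants of a Hopf bimodule *)

Section Cancellation.
Variables (k : fieldType) (P : hopfAlgType k).

Lemma antipode1 : antipode 1 = 1 :> P.
Proof.
have := antipodel (1 : P); rewrite comul1 counit1 scale1r.
by rewrite sweedler_pure ?mulr1 //; lin.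
Qed.

(** Sending h to the map v ↦ v_1 |> h(v_2) has a left inverse, given by the antipode: S(v_1) |> (v_2
    |> h(v_3)) = counit(v_1) h(v_2) = h(v). *)
Lemma coaction_cancel (V M : lmodType k) (d : left_comodule P V)
    (a : left_module P M) (f g : V -> M) :
  linear f -> linear g ->
  (forall v, \sw_(p ⊗ w <- d v) a p (f w) = \sw_(p ⊗ w <- d v) a p (g w)) ->
  f =1 g.
Proof.
move=> fL gL fg v.
have invP (h : V -> M) : linear h ->
    \sw_(p ⊗ w <- d v) a (antipode p) (\sw_(q ⊗ u <- d w) a q (h u)) = h v.
  move=> hL; rewrite -[RHS](sweedler_lcounit d) //; sw_l.
  rewrite (sweedler_lcoactA d (F := fun p q u => a (antipode p) (a q (h u))));
    last by lin.
  apply: eq_sweedler => p w.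
  transitivity (a (\sw_(b ⊗ c <- comul p) antipode b * c) (h w)).
    by sw_r; apply: eq_sweedler => b c; rewrite lactM.
  by rewrite antipodel (linear_homo _ _ ((lact_bilinear a).1 _)) lact1.
rewrite -(invP f) // -(invP g) //.
by apply: eq_sweedler => p w; rewrite fg.
Qed.

Variables (Y W : lmodType k) (a : left_module P Y).

(** The action that makes the coaction of a Hopf module P-linear, by [hopf_lact_lcoact]. *)
Definition diag_lact (q : P) (t : P ⊗ Y) : P ⊗ Y :=
  \sw_(b ⊗ c <- comul q) \sw_(p ⊗ y <- t) (b * p) ⊗ a c y.

Lemma diag_lact_bilinear : bilinear_map diag_lact.
Proof. by rewrite /diag_lact; lin. Qed.

Lemma diag_lact1 t : diag_lact 1 t = t.
Proof.
rewrite /diag_lact comul1 [RHS]tensorE; sw_l; apply: eq_sweedler => p y.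
by rewrite mul1r lact1.
Qed.

Lemma diag_lactM q r t : diag_lact (q * r) t = diag_lact q (diag_lact r t).
Proof.
rewrite /diag_lact comulM; sw; apply: eq_sweedler => b c.
apply: eq_sweedler => d e; apply: eq_sweedler => p y.
by rewrite mulrA lactM.
Qed.

Definition diag_module : left_module P (P ⊗ Y)%type :=
  LeftModule diag_lact_bilinear diag_lact1 diag_lactM.

Definition tensor_lact (q : P) (t : Y ⊗ W) : Y ⊗ W :=
  \sw_(y ⊗ w <- t) a q y ⊗ w.

Lemma tensor_lact_bilinear : bilinear_map tensor_lact.
Proof. by rewrite /tensor_lact; lin. Qed.

Lemma tensor_lact1 t : tensor_lact 1 t = t.
Proof. by rewrite [RHS]tensorE; apply: eq_sweedler => y w; rewrite lact1. Qed.

Lemma tensor_lactM q r t :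
  tensor_lact (q * r) t = tensor_lact q (tensor_lact r t).
Proof.
by rewrite /tensor_lact; sw_r; apply: eq_sweedler => y w; rewrite lactM.
Qed.

Definition tensor_module : left_module P (Y ⊗ W)%type :=
  LeftModule tensor_lact_bilinear tensor_lact1 tensor_lactM.

End Cancellation.

(** * The crossed module of left coinvariants *)

Section LeftCoinvariants.
Variables (k : fieldType) (P H : hopfAlgType k) (pi : {lrmorphism P -> H}).
Local Notation B := (coinvariants pi).

Section Object.
Variable Y : hopf_bimodule pi.
Local Notation lact := (hopf_lact Y).
Local Notation lcoact := (hopf_lcoact Y).
Local Notation ract := (hopf_ract Y).
Local Notation rcoact := (hopf_rcoact Y).

Definition left_coinvariant : {pred Y} := fun y => lcoact y == 1 ⊗ y.

Lemma left_coinvariant_submod : GRing.submod_closed left_coinvariant.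
Proof.
split=> [|c y z /eqP yE /eqP zE]; apply/eqP.
  by rewrite (linear_0 (lcoact_linear _)) (linear_0 (pure_linearr _)).
by rewrite lcoact_linear yE zE pure_linearr.
Qed.

HB.instance Definition _ :=
  GRing.isSubmodClosed.Build k Y left_coinvariant left_coinvariant_submod.

Record left_coinvariants := LeftCoinvariants {
  lcoinv_val :> Y;
  lcoinv_valP : lcoinv_val \in left_coinvariant
}.

HB.instance Definition _ := [isSub for lcoinv_val].
HB.instance Definition _ := [Choice of left_coinvariants by <:].
HB.instance Definition _ := [SubChoice_isSubLmodule of left_coinvariants by <:].

Local Notation C := left_coinvariants.

Lemma lcoinv_val_linear : linear lcoinv_val.
Proof. by []. Qed.

Lemma lcoinv_val_inj : injective lcoinv_val.
Proof. exact: val_inj. Qed.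

Lemma lcoinv_lcoact (x : C) : lcoact x = 1 ⊗ (x : Y).
Proof. exact/eqP/lcoinv_valP. Qed.

Definition lcoinv_proj (y : Y) : Y :=
  \sw_(p ⊗ z <- lcoact y) lact (antipode p) z.

Lemma lcoinv_proj_linear : linear lcoinv_proj.
Proof. by rewrite /lcoinv_proj; lin. Qed.

Ltac lin_hyp ::=
  first [exact: coinv_coaction_linear | exact: lcoinv_proj_linear
        | exact: lcoinv_val_linear].

(** By coassociativity the left side is (y_1 S(y_2)) |> y_3, which the antipode axiom collapses. *)
Lemma lcoinv_projK y : \sw_(p ⊗ z <- lcoact y) lact p (lcoinv_proj z) = y.
Proof.
rewrite -[RHS](lcoact_counit lcoact) /lcoinv_proj; sw_l.
rewrite (sweedler_lcoactA lcoact
  (F := fun p q z => lact p (lact (antipode q) z)));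
  last by lin.
apply: eq_sweedler => p z.
transitivity (lact (\sw_(b ⊗ c <- comul p) b * antipode c) z).
  by sw_r; apply: eq_sweedler => b c; rewrite lactM.
by rewrite antipoder (linear_homo _ _ ((lact_bilinear lact).1 _)) lact1.
Qed.

(** By cancellation for the diagonal action, it suffices to act by y_1 on both sides taken at y_2.
    The left side becomes the coaction of y_1 |> Pi(y_2) = y, the right side y_1 ⊗ y_2 |> Pi(y_3) =
    y_1 ⊗ y_2, and these agree. *)
Lemma lcoinv_projP y : lcoinv_proj y \in left_coinvariant.
Proof.
apply/eqP; move: y.
apply: (coaction_cancel (d := lcoact) (a := diag_module lact)); try by lin.
move=> y /=; transitivity (lcoact y).
  rewrite -[in RHS](lcoinv_projK y) (linear_sw _ _ (lcoact_linear _)).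
  by apply: eq_sweedler => p z; rewrite hopf_lact_lcoact.
rewrite /diag_lact; sw_r.
rewrite -(sweedler_lcoactA lcoact
  (F := fun p q z => (p * 1) ⊗ lact q (lcoinv_proj z)));
  last by lin.
rewrite [LHS]tensorE; apply: eq_sweedler => p z.
by rewrite -[in LHS](lcoinv_projK z) mulr1; sw_l.
Qed.

Definition to_lcoinv (y : Y) : C := LeftCoinvariants (lcoinv_projP y).

Lemma to_lcoinv_linear : linear to_lcoinv.
Proof. by move=> c y z; apply: lcoinv_val_inj; exact: lcoinv_proj_linear. Qed.

Ltac lin_hyp ::=
  first [exact: coinv_coaction_linear | exact: lcoinv_proj_linear
        | exact: lcoinv_val_linear | exact: to_lcoinv_linear].

(** The coaction of p |> x is p_1 ⊗ p_2 |> x, so the projection gives S(p_1) p_2 |> x. *)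
Lemma lcoinv_proj_lact p (x : C) :
  lcoinv_proj (lact p x) = counit p *: (x : Y).
Proof.
rewrite /lcoinv_proj hopf_lact_lcoact lcoinv_lcoact; sw_l.
transitivity (lact (\sw_(b ⊗ c <- comul p) antipode b * c) x).
  by sw_r; apply: eq_sweedler => b c; rewrite lactM mulr1.
by rewrite antipodel (linear_homo _ _ ((lact_bilinear lact).1 _)) lact1.
Qed.

Lemma lcoinv_proj_id (x : C) : lcoinv_proj x = x.
Proof. by have := lcoinv_proj_lact 1 x; rewrite lact1 counit1 scale1r. Qed.

(** The coaction of x <| b is b_1 ⊗ x <| b_2, so x <| b need not be coinvariant and has to be
    projected. *)
Definition lcoinv_ract (x : C) (b : B) : C := to_lcoinv (ract x b).

Lemma lcoinv_ractE (x : C) b :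
  \sw_(p ⊗ c <- coinv_coaction b) lact p (lcoinv_ract x c) = ract x b.
Proof.
rewrite -[RHS]lcoinv_projK hopf_ract_lcoact lcoinv_lcoact; sw_r.
by apply: eq_sweedler => p c; rewrite mul1r.
Qed.

Lemma lcoinv_ract_bilinear : bilinear_map lcoinv_ract.
Proof. by rewrite /lcoinv_ract; lin. Qed.

Lemma lcoinv_ract1 x : lcoinv_ract x 1 = x.
Proof.
by apply: lcoinv_val_inj; rewrite /lcoinv_ract /= ract1 lcoinv_proj_id.
Qed.

(** Cancellation along the coaction of c, then along that of b, reduces the claim to x <| (b c) = (x
    <| b) <| c in Y. *)
Lemma lcoinv_ractM x b c :
  lcoinv_ract x (b * c) = lcoinv_ract (lcoinv_ract x b) c.
Proof.
have bL := lcoinv_ract_bilinear.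
apply: lcoinv_val_inj; move: c.
apply: (coaction_cancel (d := coinv_comodule pi) (a := lact)); try by lin.
move=> c /=; move: b.
apply: (coaction_cancel (d := coinv_comodule pi) (a := lact)); try by lin.
move=> b /=; transitivity (ract (ract x b) c).
  rewrite -ractM -lcoinv_ractE coinv_coactionM; sw.
  by apply: eq_sweedler => p d; apply: eq_sweedler => q e; rewrite lactM.
rewrite -(lcoinv_ractE x b) (linear_sw _ _ ((ract_bilinear ract).1 _)).
apply: eq_sweedler => p d.
by rewrite hopf_actC -(lcoinv_ractE (lcoinv_ract x d)).
Qed.

Definition lcoinv_right_module : right_module B C :=
  RightModule lcoinv_ract_bilinear lcoinv_ract1 lcoinv_ractM.

(** Projecting the first leg lands in C ⊗ H without a choice of lift; by [lcoinv_rcoactE] it leaves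
    the coaction of Y unchanged. *)
Definition lcoinv_rcoact (x : C) : C ⊗ H :=
  \sw_(y ⊗ h <- rcoact x) to_lcoinv y ⊗ h.

Lemma lcoinv_rcoact_linear : linear lcoinv_rcoact.
Proof. by rewrite /lcoinv_rcoact; lin. Qed.

(** The two coactions commute, so for coinvariant x the P-coaction on the first leg of the
    H-coaction of x only produces 1. Acting by the antipode of that leg of P shows that Pi fixes the
    first leg. *)
Lemma lcoinv_rcoactE (x : C) :
  \sw_(z ⊗ h <- lcoinv_rcoact x) (z : Y) ⊗ h = rcoact x.
Proof.
rewrite /lcoinv_rcoact; sw_l => /=.
have := hopf_coactC (x : Y); rewrite lcoinv_lcoact sweedler_pure; last by lin.
move=> /(congr1 (fun t => \sw_(p ⊗ s <- t) \sw_(y ⊗ h <- s)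
  (lact (antipode p) y ⊗ h))).
move=> E; apply: esym; rewrite [LHS]tensorE.
transitivity (\sw_(y ⊗ h <- rcoact x) lact (antipode 1) y ⊗ h).
  by apply: eq_sweedler => y h; rewrite antipode1 lact1.
by rewrite /lcoinv_proj; sw_r; sw_from E.
Qed.

Lemma sweedler_lcoinv_rcoact (U : lmodType k) (F : Y -> H -> U) (x : C) :
  bilinear_map F ->
  \sw_(z ⊗ h <- lcoinv_rcoact x) F z h = \sw_(y ⊗ h <- rcoact x) F y h.
Proof. by move=> FL; rewrite -lcoinv_rcoactE; sw_r. Qed.

Ltac lin_hyp ::=
  first [exact: coinv_coaction_linear | exact: lcoinv_proj_linear
        | exact: lcoinv_val_linear | exact: to_lcoinv_linear
        | exact: lcoinv_rcoact_linear].

Lemma lcoinv_rcoactA x :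
  \sw_(z ⊗ h <- lcoinv_rcoact x) z ⊗ comul h =
  \sw_(z ⊗ h <- lcoinv_rcoact x) \sw_(w ⊗ g <- lcoinv_rcoact z) w ⊗ (g ⊗ h).
Proof.
apply: (tensor_injl lcoinv_val_linear lcoinv_val_inj); sw.
rewrite (sweedler_lcoinv_rcoact (F := fun z h => z ⊗ comul h)); last by lin.
rewrite rcoactA.
rewrite -(sweedler_lcoinv_rcoact
  (F := fun z h => \sw_(w ⊗ g <- rcoact z) w ⊗ (g ⊗ h))); last by lin.
apply: eq_sweedler => z h.
by rewrite (sweedler_lcoinv_rcoact (F := fun w g => w ⊗ (g ⊗ h))); last by lin.
Qed.

Lemma lcoinv_rcoact_counit x :
  \sw_(z ⊗ h <- lcoinv_rcoact x) counit h *: z = x.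
Proof.
apply: lcoinv_val_inj; rewrite (linear_sw _ _ lcoinv_val_linear) /=.
rewrite (sweedler_lcoinv_rcoact (F := fun z h => counit h *: z)); last by lin.
exact: rcoact_counit.
Qed.

Definition lcoinv_right_comodule : right_comodule H C :=
  RightComodule lcoinv_rcoact_linear lcoinv_rcoactA lcoinv_rcoact_counit.

(** After embedding in Y ⊗ H, with P acting on Y alone, cancellation along the coaction of b turns
    both sides into the H-coaction of x <| b: the left by [hopf_ract_rcoact], the right by
    [hopf_lact_rcoact] applied to b_1 |> x.b_2. *)
Lemma lcoinv_crossed (x : C) b :
  \sw_(z ⊗ h <- lcoinv_rcoact x) lcoinv_ract z b ⊗ h =
  \sw_(p ⊗ c <- coinv_coaction b)
    \sw_(z ⊗ h <- lcoinv_rcoact (lcoinv_ract x c)) z ⊗ (pi p * h).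
Proof.
have bL := lcoinv_ract_bilinear.
apply: (tensor_injl lcoinv_val_linear lcoinv_val_inj) => /=; move: b.
apply: (coaction_cancel (d := coinv_comodule pi) (a := tensor_module H lact));
  try by lin.
move=> b; transitivity (rcoact (ract x b)) => /=; rewrite /tensor_lact.
  rewrite hopf_ract_rcoact -(sweedler_lcoinv_rcoact
    (F := fun z h => ract z b ⊗ h)); last by lin.
  sw_l; rewrite sweedler_exchange; apply: eq_sweedler => z h.
  by rewrite -lcoinv_ractE; sw_r.
rewrite -lcoinv_ractE (linear_sw _ _ (rcoact_linear _)); sw_r.
rewrite (sweedler_coinvA (F := fun p q c =>
  \sw_(z ⊗ h <- lcoinv_rcoact (lcoinv_ract x c)) lact p z ⊗ (pi q * h)));
  last by lin.
apply: eq_sweedler => p c; rewrite hopf_lact_rcoact.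
apply: eq_sweedler => q r.
by rewrite (sweedler_lcoinv_rcoact (F := fun z h => lact q z ⊗ (pi r * h)));
  last by lin.
Qed.

Definition lcoinv_module : crossed_module pi :=
  @CrossedModule _ _ _ _ C lcoinv_right_module lcoinv_right_comodule
    lcoinv_crossed.

End Object.

(** * Functoriality of left coinvariants *)

Section Morphism.
Variables (Y Z : hopf_bimodule pi) (f : hopf_bimodule_hom Y Z).

Lemma lcoinv_map_subproof (x : left_coinvariants Y) :
  f x \in @left_coinvariant Z.
Proof.
apply/eqP; rewrite hopf_fun_lcoact lcoinv_lcoact sweedler_pure //.
by apply: bilinear_pure; [exact: linear_id|exact: hopf_fun_linear].
Qed.

Definition lcoinv_map (x : left_coinvariants Y) : left_coinvariants Z :=
  LeftCoinvariants (lcoinv_map_subproof x).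

Ltac lin_hyp ::=
  first [exact: hopf_fun_linear | exact: lcoinv_val_linear
        | exact: to_lcoinv_linear].

Lemma lcoinv_map_linear : linear lcoinv_map.
Proof. by move=> a x y; apply: lcoinv_val_inj; exact: hopf_fun_linear. Qed.

Lemma hopf_fun_lcoinv_proj y : f (lcoinv_proj y) = lcoinv_proj (f y).
Proof.
rewrite /lcoinv_proj hopf_fun_lcoact; sw.
by apply: eq_sweedler => p z; rewrite hopf_fun_lact.
Qed.

Lemma lcoinv_map_ract x b :
  lcoinv_map (lcoinv_ract x b) = lcoinv_ract (lcoinv_map x) b.
Proof.
apply: lcoinv_val_inj; rewrite /lcoinv_ract /= hopf_fun_lcoinv_proj.
by rewrite hopf_fun_ract.
Qed.

Lemma lcoinv_map_rcoact x :
  lcoinv_rcoact (lcoinv_map x) =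
  \sw_(z ⊗ h <- lcoinv_rcoact x) lcoinv_map z ⊗ h.
Proof.
rewrite /lcoinv_rcoact /= hopf_fun_rcoact.
have mL := lcoinv_map_linear.
sw; apply: eq_sweedler => y h; congr (_ ⊗ _).
by apply: lcoinv_val_inj; rewrite /= hopf_fun_lcoinv_proj.
Qed.

Definition lcoinv_hom : crossed_hom (lcoinv_module Y) (lcoinv_module Z) :=
  @CrossedHom _ _ _ _ (lcoinv_module Y) (lcoinv_module Z) lcoinv_map
    lcoinv_map_linear lcoinv_map_ract lcoinv_map_rcoact.

End Morphism.

Lemma lcoinv_hom1 Y :
  lcoinv_hom (hopf_bimodule_id Y) = crossed_id (lcoinv_module Y).
Proof. by apply: crossed_hom_eq => x; exact: lcoinv_val_inj. Qed.

Lemma lcoinv_homM X Y Z (g : hopf_bimodule_hom Y Z)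
    (f : hopf_bimodule_hom X Y) :
  lcoinv_hom (hopf_bimodule_comp g f) =
  crossed_comp (lcoinv_hom g) (lcoinv_hom f).
Proof. by apply: crossed_hom_eq => x; exact: lcoinv_val_inj. Qed.

Definition lcoinv_functor :
    functor (hopf_bimodule_category pi) (crossed_category pi) :=
  @Functor (hopf_bimodule_category pi) (crossed_category pi)
    lcoinv_module lcoinv_hom lcoinv_hom1 lcoinv_homM.

End LeftCoinvariants.

(** * The equivalence *)

Section Inverses.
Variables (k : fieldType) (P H : hopfAlgType k) (pi : {lrmorphism P -> H}).

Lemma linear_inverse (U V : lmodType k) (f : U -> V) (g : V -> U) :
  linear f -> cancel f g -> cancel g f -> linear g.
Proof.
by move=> fL fK gK a u v; rewrite -[u in LHS]gK -[v in LHS]gK -fL fK.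
Qed.

Section Crossed.
Variables (X Y : crossed_module pi) (f : crossed_hom X Y) (g : Y -> X).
Hypotheses (fK : cancel f g) (gK : cancel g f).

Lemma crossed_inverse_linear : linear g.
Proof. exact: linear_inverse (crossed_fun_linear f) fK gK. Qed.

Lemma crossed_inverse_ract y b :
  g (crossed_ract Y y b) = crossed_ract X (g y) b.
Proof. by rewrite -{1}[y]gK -crossed_fun_ract fK. Qed.

Lemma crossed_inverse_rcoact y :
  crossed_rcoact X (g y) = \sw_(x ⊗ h <- crossed_rcoact Y y) g x ⊗ h.
Proof.
rewrite -{2}[y]gK crossed_fun_rcoact (sweedler_map _ _ id); last first.
  by apply: bilinear_pure; [exact: crossed_inverse_linear|exact: linear_id].
by rewrite [LHS]tensorE; apply: eq_sweedler => x h; rewrite fK.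
Qed.

Definition crossed_inverse : crossed_hom Y X :=
  CrossedHom crossed_inverse_linear crossed_inverse_ract
    crossed_inverse_rcoact.

End Crossed.

Section HopfBimodule.
Variables (X Y : hopf_bimodule pi) (f : hopf_bimodule_hom X Y) (g : Y -> X).
Hypotheses (fK : cancel f g) (gK : cancel g f).

Lemma hopf_inverse_linear : linear g.
Proof. exact: linear_inverse (hopf_fun_linear f) fK gK. Qed.

Lemma hopf_inverse_lact p y : g (hopf_lact Y p y) = hopf_lact X p (g y).
Proof. by rewrite -{1}[y]gK -hopf_fun_lact fK. Qed.

Lemma hopf_inverse_lcoact y :
  hopf_lcoact X (g y) = \sw_(p ⊗ x <- hopf_lcoact Y y) p ⊗ g x.
Proof.
rewrite -{2}[y]gK hopf_fun_lcoact (sweedler_map _ id); last first.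
  by apply: bilinear_pure; [exact: linear_id|exact: hopf_inverse_linear].
by rewrite [LHS]tensorE; apply: eq_sweedler => p x; rewrite fK.
Qed.

Lemma hopf_inverse_ract y b : g (hopf_ract Y y b) = hopf_ract X (g y) b.
Proof. by rewrite -{1}[y]gK -hopf_fun_ract fK. Qed.

Lemma hopf_inverse_rcoact y :
  hopf_rcoact X (g y) = \sw_(x ⊗ h <- hopf_rcoact Y y) g x ⊗ h.
Proof.
rewrite -{2}[y]gK hopf_fun_rcoact (sweedler_map _ _ id); last first.
  by apply: bilinear_pure; [exact: hopf_inverse_linear|exact: linear_id].
by rewrite [LHS]tensorE; apply: eq_sweedler => x h; rewrite fK.
Qed.

Definition hopf_inverse : hopf_bimodule_hom Y X :=
  HopfBimoduleHom hopf_inverse_linear hopf_inverse_lact hopf_inverse_lcoact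
    hopf_inverse_ract hopf_inverse_rcoact.

End HopfBimodule.

End Inverses.

(** * The two natural isomorphisms *)

Section Equivalence.
Variables (k : fieldType) (P H : hopfAlgType k) (pi : {lrmorphism P -> H}).
Hypothesis pi_hopf : hopf_morphism pi.
Ltac lin_hyp ::=
  first [exact: coinv_coaction_linear | exact: lcoinv_val_linear
        | exact: to_lcoinv_linear | exact: lcoinv_rcoact_linear].

Section Unit.
Variable X : crossed_module pi.
Local Notation FX := (free_bimodule pi_hopf X).

Lemma unit_subproof (x : X) : (1 ⊗ x : FX) \in @left_coinvariant _ _ _ _ FX.
Proof.
apply/eqP; rewrite /= /free_lcoact sweedler_pure; last by lin.
by rewrite comul1 sweedler_pure //; lin.
Qed.

Definition unit_fun (x : X) : left_coinvariants FX :=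
  LeftCoinvariants (unit_subproof x).

Lemma unit_fun_linear : linear unit_fun.
Proof. by move=> a x y; apply: lcoinv_val_inj; exact: pure_linearr. Qed.

(** In P ⊗ X one has (1 ⊗ x) <| b = b_1 |> (1 ⊗ x <| b_2), and Pi replaces the action of b_1 by its
    counit. *)
Lemma unit_fun_ract x b :
  unit_fun (crossed_ract X x b) = lcoinv_ract (unit_fun x) b.
Proof.
have uL := unit_fun_linear; apply: lcoinv_val_inj.
transitivity (lcoinv_proj (\sw_(p ⊗ c <- coinv_coaction b)
  hopf_lact FX p (unit_fun (crossed_ract X x c)))).
  rewrite (linear_sw _ _ (@lcoinv_proj_linear _ _ _ _ FX)).
  rewrite -(sweedler_coinv_counit
    (F := fun c => lcoinv_val (unit_fun (crossed_ract X x c)))); last by lin.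
  by apply: eq_sweedler => p c; rewrite lcoinv_proj_lact.
apply: (congr1 (@lcoinv_proj _ _ _ _ FX)) => /=.
rewrite /free_ract /free_lact; sw; apply: eq_sweedler => p c.
by rewrite mul1r mulr1.
Qed.

Lemma unit_fun_rcoact x :
  lcoinv_rcoact (unit_fun x) =
  \sw_(y ⊗ h <- crossed_rcoact X x) unit_fun y ⊗ h.
Proof.
have uL := unit_fun_linear.
apply: (tensor_injl (@lcoinv_val_linear _ _ _ _ FX)
  (@lcoinv_val_inj _ _ _ _ FX)).
rewrite lcoinv_rcoactE /= /free_rcoact sweedler_pure; last by lin.
rewrite comul1; sw.
by apply: eq_sweedler => y h; rewrite rmorph1 mul1r.
Qed.

Definition unit_hom : crossed_hom X (lcoinv_module FX) :=
  @CrossedHom _ _ _ _ X (lcoinv_module FX) unit_fun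
    unit_fun_linear unit_fun_ract unit_fun_rcoact.

Definition unit_inv (t : left_coinvariants FX) : X :=
  \sw_(p ⊗ x <- lcoinv_val t) counit p *: x.

Lemma unit_funK : cancel unit_fun unit_inv.
Proof.
move=> x; rewrite /unit_inv /= sweedler_pure; last by lin.
by rewrite counit1 scale1r.
Qed.

(** For t = p ⊗ x coinvariance reads p_1 ⊗ (p_2 ⊗ x) = 1 ⊗ (p ⊗ x), with sums understood; the counit
    on the middle leg gives p ⊗ x = 1 ⊗ counit(p) x. *)
Lemma unit_invK : cancel unit_inv unit_fun.
Proof.
move=> t; apply: lcoinv_val_inj => /=.
have := lcoinv_lcoact t; rewrite /= /free_lcoact.
move=> /(congr1 (fun s => \sw_(a ⊗ v <- s) \sw_(p ⊗ x <- v)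
  counit p *: (a ⊗ x))) E.
transitivity (\sw_(p ⊗ x <- lcoinv_val t) \sw_(a ⊗ b <- comul p)
  counit b *: (a ⊗ x)); last first.
  rewrite [RHS]tensorE; apply: eq_sweedler => p x.
  by apply: (sweedler_counitr (F := fun a => a ⊗ x)); lin.
apply: esym; rewrite /unit_inv; sw_r.
transitivity (\sw_(p ⊗ x <- lcoinv_val t) counit p *: (1 ⊗ x : P ⊗ X)).
  by sw_from E.
by apply: eq_sweedler => p x; rewrite (linear_homo _ _ (pure_linearr _)).
Qed.

End Unit.

Section Counit.
Variable Y : hopf_bimodule pi.
Local Notation GY := (lcoinv_module Y).

Definition counit_fun (t : P ⊗ GY) : Y :=
  \sw_(p ⊗ z <- t) hopf_lact Y p (z : left_coinvariants Y).

Lemma counit_fun_linear : linear counit_fun.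
Proof. by rewrite /counit_fun; lin. Qed.

Lemma counit_fun_lact p t :
  counit_fun (free_lact p t) = hopf_lact Y p (counit_fun t).
Proof.
rewrite /counit_fun /free_lact; sw; apply: eq_sweedler => q z.
by rewrite lactM.
Qed.

Lemma counit_fun_lcoact t :
  hopf_lcoact Y (counit_fun t) =
  \sw_(p ⊗ v <- free_lcoact t) p ⊗ counit_fun v.
Proof.
rewrite /counit_fun /free_lcoact; sw; apply: eq_sweedler => p z.
rewrite hopf_lact_lcoact lcoinv_lcoact; sw_l.
by apply: eq_sweedler => a b; rewrite mulr1.
Qed.

Lemma counit_fun_ract t b :
  counit_fun (free_ract t b) = hopf_ract Y (counit_fun t) b.
Proof.
have bL := @lcoinv_ract_bilinear _ _ _ _ Y.
rewrite /counit_fun /free_ract; sw; apply: eq_sweedler => p z.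
rewrite hopf_actC -lcoinv_ractE; sw_r.
by apply: eq_sweedler => q c; rewrite lactM.
Qed.

Lemma counit_fun_rcoact t :
  hopf_rcoact Y (counit_fun t) =
  \sw_(v ⊗ h <- free_rcoact t) counit_fun v ⊗ h.
Proof.
rewrite /counit_fun /free_rcoact; sw; apply: eq_sweedler => p z.
rewrite hopf_lact_rcoact; apply: eq_sweedler => a b.
by rewrite (sweedler_lcoinv_rcoact
  (F := fun y h => hopf_lact Y a y ⊗ (pi b * h))); last by lin.
Qed.

Definition counit_hom : hopf_bimodule_hom (free_bimodule pi_hopf GY) Y :=
  @HopfBimoduleHom _ _ _ _ (free_bimodule pi_hopf GY) Y counit_fun
    counit_fun_linear counit_fun_lact counit_fun_lcoact counit_fun_ract
    counit_fun_rcoact.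

Definition counit_inv (y : Y) : P ⊗ GY :=
  \sw_(p ⊗ z <- hopf_lcoact Y y) p ⊗ to_lcoinv z.

Lemma counit_invK : cancel counit_inv counit_fun.
Proof.
move=> y; rewrite /counit_inv /counit_fun -[RHS]lcoinv_projK.
by sw_l.
Qed.

(** The coaction of p |> z is p_1 ⊗ p_2 |> z, and Pi(p_2 |> z) = counit(p_2) z. *)
Lemma counit_funK : cancel counit_fun counit_inv.
Proof.
move=> t; rewrite /counit_inv counit_fun_lcoact /free_lcoact [RHS]tensorE.
rewrite /counit_fun; sw_l; apply: eq_sweedler => p z.
rewrite -[RHS](sweedler_counitr (F := fun a => a ⊗ z)); last by lin.
apply: eq_sweedler => a b; rewrite -(linear_homo _ _ (pure_linearr _)).
congr (_ ⊗ _); apply: lcoinv_val_inj; exact: lcoinv_proj_lact.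
Qed.

End Counit.

Local Notation F := (free_functor pi_hopf).
Local Notation G := (lcoinv_functor pi).

Definition unit_nat_iso :
  nat_iso (functor_comp G F) (functor_id (crossed_category pi)).
Proof.
unshelve refine (@NatIso _ _ (functor_comp G F)
  (functor_id (crossed_category pi))
  (* The components run from the coinvariants of P ⊗ X to X, so the inverse of [unit_hom] comes
     first; naturality is then read off from its formula [unit_inv]. *)
  (fun X => crossed_inverse (f := unit_hom X) (@unit_funK X) (@unit_invK X))
  (fun X => unit_hom X) _ _ _).
- by move=> X; apply: crossed_hom_eq => t; exact: unit_invK.
- by move=> X; apply: crossed_hom_eq => t; exact: unit_funK.
move=> X Y f; apply: crossed_hom_eq => t.
rewrite /= /unit_inv /= /free_map.
have fL := crossed_fun_linear f; sw; apply: eq_sweedler => p x.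
by rewrite (linear_homo _ _ fL).
Defined.

Definition counit_nat_iso :
  nat_iso (functor_comp F G) (functor_id (hopf_bimodule_category pi)).
Proof.
unshelve refine (@NatIso _ _ (functor_comp F G)
  (functor_id (hopf_bimodule_category pi))
  (fun Y => counit_hom Y)
  (fun Y => hopf_inverse (f := counit_hom Y) (@counit_funK Y) (@counit_invK Y))
  _ _ _).
- by move=> Y; apply: hopf_bimodule_hom_eq => t; exact: counit_funK.
- by move=> Y; apply: hopf_bimodule_hom_eq => t; exact: counit_invK.
move=> Y Z f; apply: hopf_bimodule_hom_eq => t.
rewrite /= /counit_fun /= /free_map.
have fL := hopf_fun_linear f; have mL := lcoinv_map_linear f.
sw; apply: eq_sweedler => p z.
by rewrite hopf_fun_lact.
Defined.

End Equivalence.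

Theorem theorem3p2 (k : fieldType) (P H : hopfAlgType k)
    (pi : {lrmorphism P -> H}) (pi_hopf : hopf_morphism pi)
    (pi_surj : forall h : H, exists p : P, pi p = h) :
  equivalent_categories (crossed_category pi) (hopf_bimodule_category pi).
Proof.
exists (free_functor pi_hopf), (lcoinv_functor pi); split; apply: inhabits.
- exact: unit_nat_iso.
- exact: counit_nat_iso.
Qed.
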